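(* Let $R$ be an associative ring with identity. The following assertions are equivalent: (1) The ring $R$ is quasi-Frobenius (QF). (2) For any two left $R$-modules $M$ and $N$, $N\in\mathfrak{F}^{-1}(M)$ if and only if $M\in\underline{\mathfrak{In}}^{-1}(N)$.
   Context: Modules are unital left $R$-modules. A flat precover of a module $N$ is a morphism $g:F\to N$ with $F$ flat such that $\mathrm{Hom}(F',F)\to\mathrm{Hom}(F',N)$ is surjective for every flat module $F'$. The flat-precover completing domain $\mathfrak{F}^{-1}(M)$ is the class of all modules $N$ such that for every morphism $f:M\to N$ and every flat precover $g:F\to N$ there is a morphism $h:M\to F$ with $gh=f$. The subinjectivity domain $\underline{\mathfrak{In}}^{-1}(N)$ of a module $N$ is the class of all modules $M$ such that for every module $K$ containing $M$ as a submodule and every morphism $f:M\to N$ there is a morphism $g:K\to N$ with $g|_M=f$. *)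

(* Defs.v *)
From HB Require Import structures.
From mathcomp Require Import all_boot all_algebra.
From mathcomp Require Import generic_quotient ring_quotient boolp.
From mathcomp Require Import freeg.

Set Implicit Arguments.
Unset Strict Implicit.
Unset Printing Implicit Defensive.

Import GRing.Theory.

Local Open Scope ring_scope.
Local Open Scope quotient_scope.

(* Left R-modules are terms of [lmodType R], right R-modules are terms of     *)
(* [lmodType R^c]: for [A : lmodType R^c], [r *: a] is the element a r.       *)

Section Tensor.
Variables (R : pzRingType) (A : lmodType R^c) (M : lmodType R).

Local Notation Z_AM := {freeg (A * M)%type / int}.

Definition formal_tensor (a : A) (m : M) : Z_AM := Freeg [:: (1, (a, m))].

Inductive tensor_relations : Z_AM -> Prop :=
| TensorRelDl a a' m : tensor_relations
    (formal_tensor (a + a') m - (formal_tensor a m + formal_tensor a' m))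
| TensorRelDr a m m' : tensor_relations
    (formal_tensor a (m + m') - (formal_tensor a m + formal_tensor a m'))
| TensorRelZ (r : R) a m : tensor_relations
    (formal_tensor ((r : R^c) *: a) m - formal_tensor a (r *: m))
| TensorRel0 : tensor_relations 0
| TensorRelB x y : tensor_relations x -> tensor_relations y ->
    tensor_relations (x - y).

Definition tensor_ker : {pred Z_AM} := fun x => `[< tensor_relations x >].

Fact tensor_ker_zmod_closed : zmod_closed tensor_ker.
Proof.
split=> [|x y /asboolP xI /asboolP yI]; apply/asboolP.
  exact: TensorRel0.
exact: TensorRelB.
Qed.

HB.instance Definition _ :=
  GRing.isZmodClosed.Build Z_AM tensor_ker tensor_ker_zmod_closed.

Definition tensor : zmodType := Quotient.quot tensor_ker.

Definition tens (a : A) (m : M) : tensor :=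
  \pi_(Quotient.quot tensor_ker) (formal_tensor a m).

Lemma tensDl a a' m : tens (a + a') m = tens a m + tens a' m.
Proof.
rewrite /tens -raddfD; apply/eqP; rewrite -Quotient.idealrBE.
by apply/asboolP; apply: TensorRelDl.
Qed.

Lemma tensDr a m m' : tens a (m + m') = tens a m + tens a m'.
Proof.
rewrite /tens -raddfD; apply/eqP; rewrite -Quotient.idealrBE.
by apply/asboolP; apply: TensorRelDr.
Qed.

Lemma tensZ (r : R) a m : tens ((r : R^c) *: a) m = tens a (r *: m).
Proof.
apply/eqP; rewrite -Quotient.idealrBE.
by apply/asboolP; apply: TensorRelZ.
Qed.

(* The homomorphism induced by a balanced map [f]; for other [f] its values   *)
(* are arbitrary. [zmodule T] is [T] as a module over [int].                *)
Definition tensor_lift (T : zmodType) (f : A -> M -> T) (x : tensor) : T :=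
  fglift (fun am => f am.1 am.2 : zmodule T) (repr x).

Definition balanced (T : zmodType) (f : A -> M -> T) : Prop :=
  [/\ forall a a' m, f (a + a') m = f a m + f a' m,
      forall a m m', f a (m + m') = f a m + f a m' &
      forall (r : R) a m, f ((r : R^c) *: a) m = f a (r *: m)].

Section Lift.
Variables (T : zmodType) (f : A -> M -> T).
Hypothesis f_bal : balanced f.

Let F : Z_AM -> T := fglift (fun am => f am.1 am.2 : zmodule T).

Let FB : zmod_morphism F.
Proof.
exact: (@lift_is_additive _ _ (zmodule T) (fun am => f am.1 am.2)).
Qed.

Let F1 a m : F (formal_tensor a m) = f a m.
Proof. by rewrite /F liftU scale1r. Qed.

Let F0 : F 0 = 0.
Proof. by have := FB 0 0; rewrite !subrr. Qed.

Let FD x y : F (x + y) = F x + F y.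
Proof. by rewrite -{1}[y]opprK -[- y]sub0r !FB F0 sub0r opprK. Qed.

Let F_ker x : x \in tensor_ker -> F x = 0.
Proof.
case: f_bal => fDl fDr fZ /asboolP; elim=> {x}.
- by move=> a a' m; rewrite FB FD !F1 fDl subrr.
- by move=> a m m'; rewrite FB FD !F1 fDr subrr.
- by move=> r a m; rewrite FB !F1 fZ subrr.
- exact: F0.
by move=> x y _ Fx _ Fy; rewrite FB Fx Fy subrr.
Qed.

Let tensor_lift_pi x :
  tensor_lift f (\pi_(Quotient.quot tensor_ker) x) = F x.
Proof.
rewrite /tensor_lift -/F; apply/eqP; rewrite -subr_eq0 -FB; apply/eqP/F_ker.
by rewrite Quotient.idealrBE reprK.
Qed.

Lemma tensor_lift_tens a m : tensor_lift f (tens a m) = f a m.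
Proof. by rewrite tensor_lift_pi F1. Qed.

Lemma tensor_lift_zmod_morphism : zmod_morphism (tensor_lift f).
Proof.
move=> x y; rewrite -[x]reprK -[y]reprK.
by rewrite -raddfB !tensor_lift_pi FB.
Qed.

End Lift.
End Tensor.

Definition tensor_map (R : pzRingType) (A B : lmodType R^c) (i : A -> B)
    (M : lmodType R) : tensor A M -> tensor B M :=
  tensor_lift (fun a m => tens (i a) m).

Lemma tensor_map_balanced (R : pzRingType) (A B : lmodType R^c)
    (i : {linear A -> B}) (M : lmodType R) :
  balanced (fun (a : A) (m : M) => tens (i a) m).
Proof.
split=> [a a' m|a m m'|r a m]; first by rewrite linearD tensDl.
  by rewrite tensDr.
by rewrite linearZ tensZ.
Qed.

Definition flat (R : pzRingType) (M : lmodType R) : Prop :=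
  forall (A B : lmodType R^c) (i : {linear A -> B}),
    injective i -> injective (@tensor_map R A B i M).

Definition flat_precover (R : pzRingType) (N F : lmodType R)
    (g : {linear F -> N}) : Prop :=
  flat F /\
  forall F' : lmodType R, flat F' ->
    forall u : {linear F' -> N}, exists v : {linear F' -> F}, g \o v =1 u.

(* [flat_precover_completing_domain M N] reads: N is in F^{-1}(M). *)
Definition flat_precover_completing_domain (R : pzRingType)
    (M N : lmodType R) : Prop :=
  forall (f : {linear M -> N}) (F : lmodType R) (g : {linear F -> N}),
    flat_precover g -> exists h : {linear M -> F}, g \o h =1 f.

(* [subinjectivity_domain N M] reads: M is in In^{-1}(N). A module containing *)
(* M as a submodule is given with the inclusion [i].                          *)
Definition subinjectivity_domain (R : pzRingType) (N M : lmodType R) : Prop :=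
  forall (K : lmodType R) (i : {linear M -> K}), injective i ->
    forall f : {linear M -> N}, exists g : {linear K -> N}, g \o i =1 f.

Definition injective_module (R : pzRingType) (E : lmodType R) : Prop :=
  forall (A B : lmodType R) (i : {linear A -> B}), injective i ->
    forall f : {linear A -> E}, exists g : {linear B -> E}, g \o i =1 f.

Definition left_ideal (R : pzRingType) (I : R -> Prop) : Prop :=
  [/\ I 0, forall x y, I x -> I y -> I (x + y) & forall r x, I x -> I (r * x)].

Definition left_noetherian (R : pzRingType) : Prop :=
  forall I : nat -> R -> Prop,
    (forall n, left_ideal (I n)) ->
    (forall n x, I n x -> I n.+1 x) ->
    exists n, forall m x, (n <= m)%N -> I m x -> I n x.

(* One-sided textbook definition; the notion is left-right symmetric. *)
Definition quasi_Frobenius (R : pzRingType) : Prop :=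
  left_noetherian R /\ injective_module (R^o : lmodType R).

(* Main.v *)
From HB Require Import structures.
Require Import Defs.
From mathcomp Require Import all_boot all_algebra.
From mathcomp Require Import generic_quotient ring_quotient.
From mathcomp Require Import boolp classical_sets functions.
From mathcomp Require Import freeg.

Set Implicit Arguments.
Unset Strict Implicit.
Unset Printing Implicit Defensive.

Import GRing.Theory Num.Theory.

Local Open Scope ring_scope.

(** Flatness is used through the equational criterion: a module [F] is flat iff
every finite system of relations [a x = 0] in [F] is explained by [x = c y] with
[a c = 0].

Suppose that all flat left modules are injective. The kernel of a surjection
[P -> F] between flat modules is pure in [P], hence flat, hence injective, so the
surjection splits; in particular the free cover [R^(N) -> N] is a flat precover.

If [R] is quasi-Frobenius, left ideals are finitely presented and a map from a left
ideal to a flat module factors through a finite free, hence injective, module; by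
Baer's criterion flat modules are injective. So a map [M -> N] that factors through
[R^(N)] extends to every overmodule of [M]. Conversely every [M] embeds in the flat
module [R^(M)]: nonzero modules have simple submodules, and every simple module
embeds in [R]. Hence a map [M -> N] that extends to [R^(M)] factors through every
flat precover of [N].

If (2) holds, a flat [M] has every [N] in its completing domain, so it splits off
every overmodule and is injective; an injective [E] has itself in its completing
domain, so it is a direct summand of [R^(E)] and is flat. Thus [E^(nat)] is injective
for every injective [E], and [R] is left noetherian by the Bass-Papp argument. *)

(** * Submodules and finitely supported functions *)

Definition linear_fun (R : pzRingType) (U V : lmodType R) (f : U -> V)
    (f_lin : linear f) : {linear U -> V} :=
  HB.pack f (GRing.isLinear.Build R U V *:%R f f_lin).

Definition is_submodule (R : pzRingType) (V : lmodType R) (S : V -> Prop) :=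
  [/\ S 0, forall x y, S x -> S y -> S (x + y) & forall r x, S x -> S (r *: x)].

(** Partial maps are total functions with linearity required only on [S]; their values elsewhere
    carry no information. *)
Definition linear_on (R : pzRingType) (V W : lmodType R) (S : V -> Prop)
    (f : V -> W) :=
  (forall x y, S x -> S y -> f (x + y) = f x + f y) /\
  (forall r x, S x -> f (r *: x) = r *: f x).

Section SubmoduleTheory.
Variables (R : pzRingType) (V : lmodType R) (S : V -> Prop).
Hypothesis S_sub : is_submodule S.

Lemma submodule0 : S 0. Proof. by case: S_sub. Qed.
Lemma submoduleD x y : S x -> S y -> S (x + y).
Proof. by case: S_sub => _ + _; apply. Qed.
Lemma submoduleZ r x : S x -> S (r *: x).
Proof. by case: S_sub => _ _; apply. Qed.
Lemma submoduleN x : S x -> S (- x).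
Proof. by rewrite -scaleN1r; apply: submoduleZ. Qed.
Lemma submoduleB x y : S x -> S y -> S (x - y).
Proof. by move=> Sx Sy; apply: submoduleD => //; apply: submoduleN. Qed.

End SubmoduleTheory.

Lemma linear_on_sum (R : pzRingType) (V W : lmodType R) (S : V -> Prop)
    (f : V -> W) (I : Type) (r : seq I) (P : pred I) (F : I -> V) :
    is_submodule S -> linear_on S f -> (forall i, P i -> S (F i)) ->
  f (\sum_(i <- r | P i) F i) = \sum_(i <- r | P i) f (F i).
Proof.
move=> S_sub [fD fZ] SF.
suff: S (\sum_(i <- r | P i) F i) /\
    f (\sum_(i <- r | P i) F i) = \sum_(i <- r | P i) f (F i) by case.
have S0 := submodule0 S_sub.
elim/big_rec2: _ => [|i y x Pi [Sx <-]].
  by split=> //; rewrite -[X in f X](scale0r (0 : V)) fZ // scale0r.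
by split; [apply: submoduleD => //; apply: SF | rewrite fD //; apply: SF].
Qed.

Section Submod.
Variables (R : pzRingType) (V : lmodType R) (S : V -> Prop).
Variable S_sub : is_submodule S.

(** The proof of [is_submodule S] is an argument so that the submodule structure can be attached to
    the predicate itself. *)
Definition submod_pred of is_submodule S : {pred V} := fun x => `[< S x >].

Fact submod_pred_closed : submod_closed (submod_pred S_sub).
Proof.
split=> [|r x y /asboolP Sx /asboolP Sy]; apply/asboolP.
  exact: submodule0 S_sub.
by apply: submoduleD => //; apply: submoduleZ.
Qed.
HB.instance Definition _ :=
  GRing.isSubmodClosed.Build R V (submod_pred S_sub) submod_pred_closed.

Record submod := Submod {
  submod_val :> V; submod_valP : submod_val \in submod_pred S_sub }.
HB.instance Definition _ := [isSub for submod_val].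
HB.instance Definition _ := [Choice of submod by <:].
HB.instance Definition _ := [SubChoice_isSubLmodule of submod by <:].

Definition submod_in (x : V) (Sx : S x) : submod :=
  @Submod x (introT (asboolP _) Sx).

Lemma submodP (x : submod) : S (submod_val x).
Proof. exact/asboolP/submod_valP. Qed.

Lemma submod_val_linear : linear submod_val.
Proof. by []. Qed.

Definition submod_incl := linear_fun submod_val_linear.

Lemma submod_incl_inj : injective submod_incl.
Proof. exact: val_inj. Qed.

End Submod.

(** Injectivity in the form used for partial maps on a submodule given by a predicate, without
    naming a source module. *)
Lemma injective_extend (R : pzRingType) (E B : lmodType R) (S : B -> Prop)
    (f : B -> E) :
    injective_module E -> is_submodule S -> linear_on S f ->
  exists g : {linear B -> E}, forall x, S x -> g x = f x.
Proof.
move=> E_inj S_sub [fD fZ].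
have f_lin : linear (fun x : submod S_sub => f (submod_val x)).
  move=> r x y /=; rewrite fD ?fZ //; first exact: submodP.
    by apply: submoduleZ => //; apply: submodP.
  exact: submodP.
have [g gE] := E_inj _ _ _ (@submod_incl_inj _ _ _ S_sub) (linear_fun f_lin).
by exists g => x Sx; apply: (gE (submod_in S_sub Sx)).
Qed.

Section FinSupp.
Variables (R : pzRingType) (X : choiceType) (V : lmodType R).

Definition finsupp_fun (f : X -> V) :=
  exists s : seq X, forall x, x \notin s -> f x = 0.

Lemma finsupp_submodule : is_submodule finsupp_fun.
Proof.
split=> [|f g [s fs] [t gt]|r f [s fs]]; first by exists [::].
  exists (s ++ t) => x; rewrite mem_cat negb_or => /andP[xs xt].
  by rewrite -[RHS]addr0 -{1}(fs x) // -(gt x).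
by exists s => x xs; rewrite -(scaler0 _ r) -(fs x).
Qed.

(** The direct sum of copies of [V] indexed by [X]. *)
Definition finsupp : lmodType R := submod finsupp_submodule.

Definition fseval (f : finsupp) : X -> V := submod_val f.

Lemma fsext (f g : finsupp) : fseval f =1 fseval g -> f = g.
Proof. by move=> /funext fg; apply: val_inj. Qed.

Lemma fsevalD f g x : fseval (f + g) x = fseval f x + fseval g x.
Proof. by []. Qed.
Lemma fsevalZ r f x : fseval (r *: f) x = r *: fseval f x.
Proof. by []. Qed.
Lemma fseval0 x : fseval 0 x = 0.
Proof. by []. Qed.

Lemma fseval_sum (I : Type) (r : seq I) (P : pred I) (F : I -> finsupp) x :
  fseval (\sum_(i <- r | P i) F i) x = \sum_(i <- r | P i) fseval (F i) x.
Proof. by elim/big_rec2: _ => // i y f _ <-; rewrite fsevalD. Qed.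

Lemma finsuppP (f : finsupp) :
  exists2 s : seq X, uniq s & forall x, x \notin s -> fseval f x = 0.
Proof.
have [s sP] := submodP f; exists (undup s); first exact: undup_uniq.
by move=> x; rewrite mem_undup; apply: sP.
Qed.

Definition fsingle_fun (x : X) (v : V) : X -> V := fun y => if y == x then v else 0.

Lemma fsingle_finsupp x v : finsupp_fun (fsingle_fun x v).
Proof.
by exists [:: x] => y; rewrite inE /fsingle_fun => /negPf ->.
Qed.

Definition fsingle x v : finsupp := submod_in finsupp_submodule (fsingle_finsupp x v).

Lemma fsingleE x v y : fseval (fsingle x v) y = if y == x then v else 0.
Proof. by []. Qed.

Lemma fsingle_linear x : linear (fsingle x).
Proof.
move=> r u v; apply: fsext => y; rewrite fsevalD fsevalZ !fsingleE.
by case: eqP => // _; rewrite scaler0 addr0.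
Qed.

Lemma finsupp_sumE (f : finsupp) (s : seq X) : uniq s ->
    (forall x, x \notin s -> fseval f x = 0) ->
  f = \sum_(x <- s) fsingle x (fseval f x).
Proof.
move=> s_uniq fs; apply: fsext => y; rewrite fseval_sum.
have [ys|ys] := boolP (y \in s); last first.
  rewrite fs // big_seq big1 // => x xs; rewrite fsingleE ifN //.
  by apply: contraNneq ys => ->.
rewrite (bigD1_seq y) // fsingleE eqxx big1 => [|x]; first by rewrite /= addr0.
by rewrite eq_sym fsingleE => /negPf ->.
Qed.

End FinSupp.

Section FreeModule.
Variables (R : pzRingType) (X : choiceType).

Definition free_module : lmodType R := finsupp X (R^o : lmodType R).
Definition free_gen (x : X) : free_module := fsingle x (1 : R^o).

Variables (V : lmodType R) (phi : X -> V).

Definition free_supp (f : free_module) : seq X := s2val (cid2 (finsuppP f)).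

Definition free_lift_fun (f : free_module) : V :=
  \sum_(x <- free_supp f) (fseval f x : R) *: phi x.

(** Independence of the chosen support list: each sum reduces to the one over the points with
    nonzero coefficient. *)
Lemma free_lift_funE (f : free_module) (s : seq X) : uniq s ->
    (forall x, x \notin s -> fseval f x = 0) ->
  free_lift_fun f = \sum_(x <- s) (fseval f x : R) *: phi x.
Proof.
rewrite /free_lift_fun /free_supp; case: cid2 => t /= t_uniq ft s_uniq fs.
pose G x := (fseval f x : R) *: phi x.
have reduce (w : seq X) :
    \sum_(x <- w) G x = \sum_(x <- [seq y <- w | fseval f y != 0]) G x.
  rewrite big_filter [LHS](bigID (fun x => fseval f x != 0)) /=.
  by rewrite [X in _ + X]big1 ?addr0 // => x /negPn/eqP fx0; rewrite /G fx0 scale0r.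
rewrite -!/(G _) (reduce t) (reduce s).
apply: perm_big; apply: uniq_perm; rewrite ?filter_uniq // => x.
rewrite !mem_filter; case: (altP (fseval f x =P 0)) => //= fx0.
have -> : x \in s by apply: contraNT fx0 => xs; rewrite fs.
by apply: contraNT fx0 => xt; rewrite ft.
Qed.

Lemma free_lift_linear : linear free_lift_fun.
Proof.
move=> r f g; have [s s_uniq fs] := finsuppP f; have [t t_uniq gt] := finsuppP g.
pose w := undup (s ++ t).
have w_uniq : uniq w by apply: undup_uniq.
have sub x : x \notin w -> (x \notin s) /\ (x \notin t).
  by rewrite mem_undup mem_cat negb_or => /andP.
rewrite !(@free_lift_funE _ w) // => [|x /sub[xs xt]|x /sub[xs xt]|x /sub[xs xt]];
  rewrite ?fsevalD ?fsevalZ ?fs ?gt ?scaler0 ?addr0 //.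
rewrite scaler_sumr -big_split /=; apply: eq_bigr => x _.
by rewrite scalerA -scalerDl.
Qed.

Definition free_lift : {linear free_module -> V} := linear_fun free_lift_linear.

Lemma free_lift_gen x : free_lift (free_gen x) = phi x.
Proof.
rewrite [LHS](@free_lift_funE _ [:: x]) // => [|y].
  by rewrite big_seq1 fsingleE eqxx scale1r.
by rewrite inE fsingleE => /negPf ->.
Qed.

End FreeModule.

Lemma free_lift_comp (R : pzRingType) (X : choiceType) (V W : lmodType R)
    (u : {linear V -> W}) (phi : X -> V) f :
  u (free_lift phi f) = free_lift (fun x => u (phi x)) f.
Proof.
have [s s_uniq fs] := finsuppP f; rewrite /= !(@free_lift_funE _ _ _ _ _ s) //.
by rewrite linear_sum; apply: eq_bigr => x _; rewrite linearZ.
Qed.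

(** * The equational criterion for flatness *)

Definition eq_flat (R : pzRingType) (F : lmodType R) : Prop :=
  forall (I J : finType) (x : I -> F) (a : J -> I -> R),
    (forall j, \sum_i a j i *: x i = 0) ->
  exists (K : finType) (y : K -> F) (c : I -> K -> R),
    (forall i, x i = \sum_k c i k *: y k) /\
    (forall j k, \sum_i a j i * c i k = 0).

Section EqFlat.
Variable R : pzRingType.
Implicit Types F G P V : lmodType R.

Lemma eq_flat_retract F G (s : {linear F -> G}) (p : {linear G -> F}) :
  (forall x, p (s x) = x) -> eq_flat G -> eq_flat F.
Proof.
move=> sK G_flat I J x a ax0.
have [|K [y [c [xE ac0]]]] := G_flat I J (fun i => s (x i)) a.
  move=> j; rewrite -[RHS](linear0 s) -(ax0 j) linear_sum.
  by apply: eq_bigr => i _; rewrite linearZ.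
exists K, (fun k => p (y k)), c; split=> // i.
rewrite -[LHS]sK xE linear_sum; apply: eq_bigr => k _; exact: linearZ.
Qed.

(** In [R] the elements are their own coefficients over the generator 1. *)
Lemma eq_flat_regular : eq_flat (R^o : lmodType R).
Proof.
move=> I J x a ax0; exists unit, (fun=> 1), (fun i _ => x i).
split=> [i|j _]; last exact: ax0.
by rewrite (big_pred1 tt) => [|[]//]; rewrite [RHS]mulr1.
Qed.

(** Finitely many coordinates are involved. The relations are solved in each of them, and the
    solutions are collected over the disjoint union of their index types. *)
Lemma eq_flat_finsupp (X : choiceType) V : eq_flat V -> eq_flat (finsupp X V).
Proof.
move=> V_flat I J x a ax0.
pose s := undup (flatten [seq s2val (cid2 (finsuppP (x i))) | i : I]).
have s_uniq : uniq s by apply: undup_uniq.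
have xs i u : u \notin s -> fseval (x i) u = 0.
  move=> us; case def_t: (cid2 (finsuppP (x i))) => [t t_uniq tP]; apply: (tP _).
  apply: contra us => ut; rewrite mem_undup; apply/flattenP; exists t => //.
  by apply/mapP; exists i; rewrite ?mem_enum // def_t.
pose el u := tnth (in_tuple s) u.
have V_sol u : exists t : {K : finType & ((K -> V) * (I -> K -> R))%type},
    (forall i, fseval (x i) (el u) = \sum_k (projT2 t).2 i k *: (projT2 t).1 k) /\
    (forall j k, \sum_i a j i * (projT2 t).2 i k = 0).
  have [|K [y [c yP]]] := V_flat I J (fun i => fseval (x i) (el u)) a.
    move=> j; rewrite -[RHS](fseval0 V (el u)) -(ax0 j) fseval_sum.
    by apply: eq_bigr.
  by exists (existT _ K (y, c)).
have [t tP] := choice V_sol.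
pose K u := projT1 (t u).
exists {u : 'I_(size s) & K u},
  (fun k => fsingle (el (tag k)) ((projT2 (t (tag k))).1 (tagged k))),
  (fun i k => (projT2 (t (tag k))).2 i (tagged k)).
split=> [i|j [u k]]; last exact: (tP u).2.
rewrite [LHS](finsupp_sumE s_uniq (xs i)) big_tnth.
rewrite -(@sig_big_dep _ _ _ _ (fun u => K u) predT (fun _ _ => true)
  (fun u k => (projT2 (t u)).2 i k *: fsingle (el u) ((projT2 (t u)).1 k))) /=.
apply: eq_bigr => u _; rewrite -/(el u) (tP u).1.
pose fsl := linear_fun (@fsingle_linear R X V (el u)).
rewrite -[LHS]/(fsl _) linear_sum; apply: eq_bigr => k _.
exact: (linearZ_LR fsl).
Qed.

Lemma eq_flat_free (X : choiceType) : eq_flat (free_module R X).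
Proof. exact/eq_flat_finsupp/eq_flat_regular. Qed.

Lemma ker_submodule V F (p : {linear V -> F}) : is_submodule (fun x => p x = 0).
Proof.
split=> [|x y px py|r x px]; first exact: linear0.
  by rewrite linearD px py addr0.
by rewrite linearZ_LR px scaler0.
Qed.

(* The kernel is pure because [F] is flat: solve the relations first in [P],
   then solve the resulting ones in [F] and lift that solution back to [P]. *)
Lemma eq_flat_ker P F (p : {linear P -> F}) :
    (forall z, exists x, p x = z) -> eq_flat P -> eq_flat F ->
  eq_flat (submod (ker_submodule p)).
Proof.
move=> p_surj P_flat F_flat I J x a ax0.
have [|K [y [b [xE ab0]]]] := P_flat I J (fun i => submod_val (x i)) a.
  move=> j; rewrite -[RHS]/(submod_incl (ker_submodule p) 0) -(ax0 j) linear_sum.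
  by apply: eq_bigr.
have [|L [z [c [yE bc0]]]] := F_flat K I (fun k => p (y k)) b.
  move=> i; rewrite -[RHS](submodP (x i)) xE linear_sum.
  by apply: eq_bigr => k _; rewrite linearZ.
have [w wE] := choice (fun l => p_surj (z l)).
(* The lifts [y k] are corrected into the kernel of [p]; the correction does not change [x i]
   because [b c = 0]. *)
pose d k := y k - \sum_l c k l *: w l.
have dK k : p (d k) = 0.
  rewrite linearB yE linear_sum; apply/eqP; rewrite subr_eq0; apply/eqP.
  by apply: eq_bigr => l _; rewrite linearZ /= wE.
exists K, (fun k => submod_in (ker_submodule p) (dK k)), b; split=> // i.
apply: (@submod_incl_inj _ _ _ (ker_submodule p)); rewrite linear_sum /= xE.
transitivity (\sum_k b i k *: d k); last by apply: eq_bigr.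
rewrite /d; under [RHS]eq_bigr do rewrite scalerBr.
rewrite sumrB; suff -> : \sum_k b i k *: (\sum_l c k l *: w l) = 0 by rewrite subr0.
under eq_bigr do rewrite scaler_sumr; rewrite exchange_big big1 // => l _ /=.
under eq_bigr do rewrite scalerA; by rewrite -scaler_suml bc0 scale0r.
Qed.

(* The kernel is flat, hence injective, hence a direct summand. *)
Lemma eq_flat_split P F (p : {linear P -> F}) :
    (forall V, eq_flat V -> injective_module V) ->
    (forall z, exists x, p x = z) -> eq_flat P -> eq_flat F ->
  exists s : {linear F -> P}, forall z, p (s z) = z.
Proof.
move=> flat_inj p_surj P_flat F_flat; pose K := submod (ker_submodule p).
have K_inj : injective_module K by apply/flat_inj/eq_flat_ker.
(* The map being extended is the identity of [K], so [rho] is a retraction of [P] onto the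
   kernel. *)
have [rho rhoE] := K_inj _ _ _ (@submod_incl_inj _ _ _ (ker_submodule p))
                             (linear_fun (fun r x y => erefl (r *: x + y) : _ = _ :> K)).
have [w wE] := choice p_surj.
(* Subtracting [rho] makes the result independent of the lift [w z]; this is [sP], from which
   linearity follows. *)
pose s z := w z - submod_val (rho (w z)).
have sP x : s (p x) = x - submod_val (rho x).
  have kx : p (w (p x) - x) = 0 by rewrite linearB wE subrr.
  have := rhoE (submod_in (ker_submodule p) kx).
  move=> /(congr1 (@submod_val _ _ _ _)) /=; rewrite linearB /= => eq_rho.
  rewrite /s -{1}[w (p x)](subrK x) -eq_rho.
  by rewrite addrAC [_ - _ - _]addrAC subrr sub0r addrC.
have s_lin : linear s.
  move=> r z z'; rewrite -(wE z) -(wE z') -linearP !sP linearP /=.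
  by rewrite scalerBr opprD addrACA.
exists (linear_fun s_lin) => z /=; rewrite -{1}(wE z) sP linearB wE.
by rewrite (submodP (rho (w z))) subr0.
Qed.

End EqFlat.

(** * Sums of elementary tensors and formal sums *)

Section TensorCalculus.
Variables (R : pzRingType) (A : lmodType R^c) (M : lmodType R).

Lemma tens0l m : tens (0 : A) m = 0 :> tensor A M.
Proof. by apply: (addrI (tens 0 m)); rewrite -tensDl !addr0. Qed.

Lemma tens0r a : tens a 0 = 0 :> tensor A M.
Proof. by apply: (addrI (tens a 0)); rewrite -tensDr !addr0. Qed.

Lemma tensNl a m : tens (- a) m = - tens a m :> tensor A M.
Proof. by apply: (addrI (tens a m)); rewrite -tensDl !subrr tens0l. Qed.

Lemma tens_suml (I : Type) (r : seq I) (P : pred I) (F : I -> A) m :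
  tens (\sum_(i <- r | P i) F i) m = \sum_(i <- r | P i) tens (F i) m :> tensor A M.
Proof. exact: (big_morph (fun a => tens a m) (fun a b => tensDl a b m) (tens0l m)). Qed.

Lemma tens_sumr (I : Type) (r : seq I) (P : pred I) a (F : I -> M) :
  tens a (\sum_(i <- r | P i) F i) = \sum_(i <- r | P i) tens a (F i) :> tensor A M.
Proof. exact: (big_morph _ (tensDr a) (tens0r a)). Qed.

(** A representative is an integer combination of formal tensors, and an integer multiple is a
    repeated sum up to sign. *)
Lemma tensor_ind (Q : tensor A M -> Prop) :
    Q 0 -> (forall x y, Q x -> Q y -> Q (x + y)) -> (forall x, Q x -> Q (- x)) ->
    (forall a m, Q (tens a m)) ->
  forall x, Q x.
Proof.
move=> Q0 QD QN Qt x; rewrite -[x]reprK; elim/freeg_ind_dom0: (repr x).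
  by rewrite raddf0.
move=> k [a m] D _ _ QD'; rewrite raddfD; apply: (QD _ _) => //.
have -> : Freeg [:: (k, (a, m))] = formal_tensor a m *~ k.
  by rewrite /formal_tensor freegU_mulz intz.
rewrite raddfMz.
have Qn n : Q (tens a m *+ n) by elim: n => [//|n IHn]; rewrite mulrS; apply: QD.
by case: k => n; rewrite ?NegzE ?mulrNz -pmulrn; [exact: Qn | apply/QN/Qn].
Qed.

Lemma tensor_span (x : tensor A M) :
  exists l : seq (A * M), x = \sum_(am <- l) tens am.1 am.2.
Proof.
elim/tensor_ind: x => [|_ _ [l ->] [l' ->]|_ [l ->]|a m].
- by exists [::]; rewrite big_nil.
- by exists (l ++ l'); rewrite big_cat.
- exists [seq (- am.1, am.2) | am <- l]; rewrite big_map -sumrN.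
  by apply: eq_bigr => am _; rewrite tensNl.
by exists [:: (a, m)]; rewrite big_seq1.
Qed.

(** It lives on formal sums, before the tensor relations are divided out, so it also serves for maps
    [f] that are not balanced. *)
Definition formal_lift (T : zmodType) (f : A -> M -> T) :
    {freeg (A * M)%type / int} -> T :=
  fglift (fun am => f am.1 am.2 : zmodule T).

Section FormalLift.
Variables (T : zmodType) (f : A -> M -> T).

Lemma formal_liftB x y : formal_lift f (x - y) = formal_lift f x - formal_lift f y.
Proof.
exact: (@lift_is_additive _ _ (zmodule T) (fun am => f am.1 am.2)).
Qed.

Lemma formal_lift1 a m : formal_lift f (formal_tensor a m) = f a m.
Proof. by rewrite /formal_lift liftU scale1r. Qed.

Lemma formal_lift0 : formal_lift f 0 = 0.
Proof. by rewrite -[X in formal_lift f X](subrr 0) formal_liftB subrr. Qed.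

Lemma formal_liftD x y : formal_lift f (x + y) = formal_lift f x + formal_lift f y.
Proof.
by rewrite -{1}[y]opprK -[- y]sub0r !formal_liftB formal_lift0 sub0r opprK.
Qed.

Lemma formal_lift_sum (I : Type) (r : seq I) (F : I -> {freeg (A * M)%type / int}) :
  formal_lift f (\sum_(i <- r) F i) = \sum_(i <- r) formal_lift f (F i).
Proof. exact: (big_morph _ formal_liftD formal_lift0). Qed.

End FormalLift.

(** Turns an equation in the quotient into a derivation from the tensor relations, on which
    induction is possible. *)
Lemma sum_tens_eq0 (I : Type) (r : seq I) (a : I -> A) (m : I -> M) :
  \sum_(i <- r) tens (a i) (m i) = 0 :> tensor A M ->
  tensor_relations (\sum_(i <- r) formal_tensor (a i) (m i)).
Proof.
move=> sum0; set x := \sum_(i <- r) _.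
have : x - 0 \in @tensor_ker R A M.
  by rewrite Quotient.idealrBE raddf_sum raddf0; apply/eqP.
by move=> /asboolP; rewrite subr0.
Qed.

End TensorCalculus.

Lemma sum_regroup (W : zmodType) (I : Type) (X : eqType) (U : seq X) (l : seq I)
    (k : I -> X) (G : I -> X -> W) :
    uniq U -> all (fun p => k p \in U) l ->
  \sum_(u <- U) \sum_(p <- l | k p == u) G p u = \sum_(p <- l) G p (k p).
Proof.
move=> U_uniq; elim: l => [|p l IHl] /=.
  by rewrite big_nil big1 // => u _; rewrite big_nil.
move=> /andP[pU /IHl {}IHl]; rewrite big_cons -IHl.
under eq_bigr do rewrite big_cons.
rewrite (bigD1_seq (k p)) //= eqxx [in RHS](bigD1_seq (k p)) //= !addrA.
by congr (_ + _); apply: eq_bigr => u; rewrite eq_sym => /negPf ->.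
Qed.

(** * Flatness by tensor products versus the equational criterion *)

Section FlatCriterion.
Variable R : pzRingType.

(* [B (x) M] is [B^(M)] modulo [B . K], where [K] is the kernel of [R^(M) -> M]:
   a vanishing sum of tensors comes with finitely many [(b, k)], [k] in [K] being
   listed as pairs (coefficient, element of [M]). *)
Lemma tensor_relations_vanish (B : lmodType R^c) (M : lmodType R) x :
    @tensor_relations R B M x ->
  exists rel : seq (B * seq (R * M)),
    (forall bk, bk \in rel -> \sum_(p <- bk.2) p.1 *: p.2 = 0) /\
    (forall u, formal_lift (fun b m => if m == u then b else 0) x =
       \sum_(bk <- rel) ((\sum_(p <- bk.2 | p.2 == u) p.1) : R^c) *: bk.1).
Proof.
elim=> {x}.
- move=> a a' m; exists [::]; split=> // u.
  rewrite formal_liftB formal_liftD !formal_lift1 big_nil.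
  by case: eqP => _; rewrite ?addr0 subrr.
(* The kernel element of [R^(M) -> M] is [[m + m'] - [m] - [m']] here and [r [m] - [r m]] for the
   balancing relation. Left additivity needs none, since it already holds in [B^(M)]. *)
- move=> a m m'; exists [:: (a, [:: (1, m + m'); (- 1, m); (- 1, m')])]; split.
    move=> bk; rewrite inE => /eqP -> /=; rewrite !big_cons big_nil /=.
    by rewrite !scaleN1r scale1r addr0 -opprD subrr.
  move=> u; rewrite formal_liftB formal_liftD !formal_lift1 big_seq1 /=.
  rewrite !big_cons big_nil /=.
  by do 3!case: eqP => _; rewrite ?addr0 ?add0r ?subr0 ?sub0r ?scalerDl ?scaleN1r
    ?scale1r ?scale0r ?opprD ?oppr0 ?subr0.
- move=> r a m; exists [:: (a, [:: (r, m); (- 1, r *: m)])]; split.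
    move=> bk; rewrite inE => /eqP -> /=; rewrite !big_cons big_nil /=.
    by rewrite scaleN1r addr0 subrr.
  move=> u; rewrite formal_liftB !formal_lift1 big_seq1 /= !big_cons big_nil /=.
  by do 2!case: eqP => _; rewrite ?addr0 ?add0r ?subr0 ?sub0r ?scalerDl ?scaleN1r
    ?scale1r ?scale0r ?oppr0 ?subr0.
- by exists [::]; split=> // u; rewrite formal_lift0 big_nil.
move=> x y _ [rel [relP relE]] _ [rel' [relP' relE']].
exists (rel ++ [seq (- bk.1, bk.2) | bk <- rel']); split.
  move=> bk; rewrite mem_cat => /orP[/relP //|/mapP[bk' /relP' bk'0 ->]].
  exact: bk'0.
move=> u; rewrite formal_liftB relE relE' big_cat big_map /= -sumrN.
by congr (_ + _); apply: eq_bigr => bk _; rewrite scalerN.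
Qed.

(** Collect a vanishing image by elements [u] of [M]. The coefficients [i (alpha u)] are then
    combinations of relations among finitely many [u]. If [u = c w] explains these relations, the
    combinations of the [alpha u] with coefficients [c] vanish under [i], hence in [A], and the
    tensor is zero. *)
Lemma eq_flat_flat (M : lmodType R) : eq_flat M -> flat M.
Proof.
move=> M_flat A B i i_inj x y eq_xy.
have mapB : zmod_morphism (@tensor_map R A B i M).
  by apply: tensor_lift_zmod_morphism; apply: tensor_map_balanced.
apply/eqP; rewrite -subr_eq0; apply/eqP; move: (mapB x y).
rewrite eq_xy subrr; move: (x - y) => z {x y eq_xy}.
have map0 : tensor_map i 0 = 0 :> tensor B M.
  by rewrite -[X in tensor_map i X](subrr 0) mapB subrr.
have mapD : {morph @tensor_map R A B i M : x y / x + y}.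
  by move=> u v; rewrite -{1}[v]opprK -[- v]sub0r !mapB map0 sub0r opprK.
have [l ->] := tensor_span z.
rewrite (big_morph _ mapD map0); under eq_bigr => am _.
  rewrite /tensor_map tensor_lift_tens; last exact: tensor_map_balanced; over.
move=> /sum_tens_eq0/tensor_relations_vanish[rel [relP relE]].
pose U := undup ([seq am.2 | am <- l] ++
                 flatten [seq [seq p.2 | p <- bk.2] | bk <- rel]).
have U_uniq : uniq U by apply: undup_uniq.
have lU : all (fun am => am.2 \in U) l.
  by apply/allP => am am_l; rewrite mem_undup mem_cat map_f.
have relU bk : bk \in rel -> all (fun p => p.2 \in U) bk.2.
  move=> bk_rel; apply/allP => p p_bk; rewrite mem_undup mem_cat.
  apply/orP; right; apply/flattenP; exists [seq p.2 | p <- bk.2].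
    by apply/mapP; exists bk.
  exact: map_f.
pose alpha u : A := \sum_(am <- l | am.2 == u) am.1.
pose coef (bk : B * seq (R * M)) u : R := \sum_(p <- bk.2 | p.2 == u) p.1.
have alphaE u : i (alpha u) = \sum_(bk <- rel) (coef bk u : R^c) *: bk.1.
  rewrite -relE formal_lift_sum /alpha linear_sum big_mkcond /=.
  by apply: eq_bigr => am _; rewrite formal_lift1.
pose el v := tnth (in_tuple U) v.
have [|K [w [c [elE ac0]]]] := M_flat _ _ el
    (fun j : 'I_(size rel) => fun v => coef (tnth (in_tuple rel) j) (el v)).
  move=> j; have j_rel := mem_tnth j (in_tuple rel).
  set bk := tnth _ _ in j_rel *.
  rewrite -(big_tnth _ _ _ xpredT (fun u => coef bk u *: u)).
  apply: etrans (relP bk j_rel).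
  rewrite -(sum_regroup (fun p u => p.1 *: u) U_uniq (relU bk j_rel)).
  by apply: eq_bigr => u _; rewrite scaler_suml.
have ca0 k : \sum_v (c v k : R^c) *: alpha (el v) = 0.
  apply: i_inj; rewrite linear0 linear_sum.
  under eq_bigr do rewrite linearZ_LR alphaE scaler_sumr.
  rewrite exchange_big big_tnth big1 // => j _.
  under eq_bigr do rewrite scalerA.
  by rewrite -scaler_suml [X in X *: _](ac0 j k) scale0r.
rewrite -(sum_regroup (fun am u => tens am.1 u) U_uniq lU).
under eq_bigr do rewrite -tens_suml -/(alpha _).
rewrite big_tnth; under eq_bigr => v _.
  rewrite -/(el v) [X in tens _ X]elE tens_sumr; under eq_bigr do rewrite -tensZ.
  over.
rewrite exchange_big big1 // => k _ /=.
by rewrite -tens_suml ca0 tens0l.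
Qed.

(* [A] is the right module generated by the columns of [a]; a relation between
   the columns with values in [F] is a sum of scalar relations [(c, y)]. *)
Lemma flat_eq_flat (F : lmodType R) : flat F -> eq_flat F.
Proof.
move=> F_flat I J x a ax0.
pose L : lmodType R^c := {ffun I -> (R^c)^o}.
pose B : lmodType R^c := {ffun J -> (R^c)^o}.
(* Scaling by [t] over [R^c] is multiplication by [t] on the right, which commutes with
   multiplication by the matrix [a] on the left. *)
pose phi_fun (r : L) : B := [ffun j => (\sum_i a j i * (r i : R)) : R].
have phi_lin : linear phi_fun.
  move=> t r r'; apply/ffunP => j; rewrite !ffunE /=.
  rewrite -[RHS]/((\sum_i a j i * (r i : R)) * (t : R) + \sum_i a j i * (r' i : R)).
  rewrite mulr_suml -big_split /=; apply: eq_bigr => i _.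
  rewrite !ffunE -[X in a j i * X]/((r i : R) * (t : R) + (r' i : R)).
  by rewrite mulrDr mulrA.
pose phi := linear_fun phi_lin.
have im_sub : is_submodule (fun b => exists r, phi r = b).
  split=> [|_ _ [r <-] [r' <-]|t _ [r <-]]; first by exists 0; rewrite linear0.
    by exists (r + r'); rewrite linearD.
  by exists (t *: r); rewrite linearZ_LR.
pose A : lmodType R^c := submod im_sub.
pose incl : {linear A -> B} := submod_incl im_sub.
have [s sE] := choice (fun b : A => submodP b).
pose corestr r : A := submod_in im_sub (ex_intro _ r erefl : exists r', phi r' = phi r).
pose e (i : I) : L := [ffun i' => (i' == i)%:R : R].
(* In the tensor product with [B] this sum becomes the sum over [j] of [d j] tensored with the
   [j]-th relation, which is zero; flatness brings the vanishing back to [A]. *)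
have map0 : \sum_i tens (corestr (e i)) (x i) = 0 :> tensor A F.
  have mapB : zmod_morphism (@tensor_map R A B incl F).
    by apply: tensor_lift_zmod_morphism; apply: tensor_map_balanced.
  have map0 : tensor_map incl 0 = 0 :> tensor B F.
    by rewrite -[X in tensor_map incl X](subrr 0) mapB subrr.
  have mapD : {morph @tensor_map R A B incl F : u v / u + v}.
    by move=> u v; rewrite -{1}[v]opprK -[- v]sub0r !mapB map0 sub0r opprK.
  apply: (F_flat _ _ incl (@submod_incl_inj _ _ _ im_sub)).
  rewrite map0 (big_morph _ mapD map0); under eq_bigr => i _.
    rewrite /tensor_map tensor_lift_tens; last exact: tensor_map_balanced.
    over.
  pose d (j : J) : B := [ffun j' => (j' == j)%:R : R].
  have phie i : phi (e i) = \sum_j (a j i : R^c) *: d j.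
    apply/ffunP => j; rewrite sum_ffunE [LHS]ffunE (bigD1 j) //= !ffunE eqxx.
    rewrite [X in _ = _ + X]big1 => [|j' /negPf j'j]; last first.
      by rewrite !ffunE eq_sym j'j scaler0.
    rewrite (bigD1 i) //= ffunE eqxx [X in _ + X]big1 => [|i' /negPf i'i]; last first.
      by rewrite ffunE i'i mulr0.
    by rewrite !addr0 mulr1 -[RHS]/((1 : R) * a j i) mul1r.
  under eq_bigr => i _ do rewrite /= -/(phi_fun _) -[phi_fun _]/(phi _) phie tens_suml.
  rewrite exchange_big big1 // => j _ /=.
  by under eq_bigr do rewrite tensZ; rewrite -tens_sumr ax0 tens0r.
(* The section [s] of [L -> A] is only a map of sets. Its defects of additivity and homogeneity lie
   in the kernel of [phi] and are what [rel] records. *)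
have [rel [relP relE]] : exists rel : seq (L * F),
    (forall cy, cy \in rel -> phi cy.1 = 0) /\
    (forall i, formal_lift (fun b y => (s b i : R) *: y)
        (\sum_i formal_tensor (corestr (e i)) (x i)) =
      \sum_(cy <- rel) (cy.1 i : R) *: cy.2).
  elim: (sum_tens_eq0 map0) => {map0}.
  - move=> b b' y; exists [:: (s (b + b') - (s b + s b'), y)]; split.
      move=> cy; rewrite inE => /eqP ->; rewrite [X in phi X]/=.
      by rewrite linearB linearD !sE subrr.
    move=> i; rewrite formal_liftB formal_liftD !formal_lift1 big_seq1 /=.
    by rewrite !ffunE scalerBl scalerDl.
  - move=> b y y'; exists [::]; split=> // i.
    by rewrite formal_liftB formal_liftD !formal_lift1 big_nil scalerDr subrr.
  - move=> r b y; exists [:: (s ((r : R^c) *: b) - (r : R^c) *: s b, y)]; split.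
      move=> cy; rewrite inE => /eqP ->; rewrite [X in phi X]/=.
      by rewrite linearB linearZ_LR !sE subrr.
    move=> i; rewrite formal_liftB !formal_lift1 big_seq1 /= !ffunE scalerBl.
    by rewrite scalerA.
  - by exists [::]; split=> // i; rewrite formal_lift0 big_nil.
  move=> u v _ [rel [relP relE]] _ [rel' [relP' relE']].
  exists (rel ++ [seq (- cy.1, cy.2) | cy <- rel']); split.
    move=> cy; rewrite mem_cat => /orP[/relP //|/mapP[cy' /relP' cy'0 ->]].
    by rewrite [X in phi X]/= linearN cy'0 oppr0.
  move=> i; rewrite formal_liftB relE relE' big_cat big_map /= -sumrN.
  by congr (_ + _); apply: eq_bigr => cy _; rewrite ffunE scaleNr.
(* The added terms compensate for the difference between [e i] and [s (corestr (e i))]. *)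
pose rel' := rel ++ [seq (e i - s (corestr (e i)), x i) | i : I].
have rel'P j : phi (tnth (in_tuple rel') j).1 = 0.
  have := mem_tnth j (in_tuple rel'); rewrite mem_cat => /orP[/relP //|].
  by move=> /mapP[i _ ->]; rewrite linearB sE subrr.
exists 'I_(size rel'), (fun k => (tnth (in_tuple rel') k).2),
  (fun i k => (tnth (in_tuple rel') k).1 i); split=> [i|j k]; last first.
  by have /ffunP/(_ j) := rel'P k; rewrite !ffunE.
rewrite -(big_tnth _ _ _ xpredT (fun cy : L * F => (cy.1 i : R) *: cy.2)).
rewrite big_cat big_map big_enum /= -relE formal_lift_sum -big_split /=.
rewrite (bigD1 i) //= formal_lift1 !ffunE eqxx [X in _ + X]big1 => [|i' /negPf i'i].
  by rewrite scalerBl scale1r addr0 addrC subrK.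
by rewrite formal_lift1 !ffunE eq_sym i'i sub0r scaleNr subrr.
Qed.

End FlatCriterion.

(** * Baer's criterion *)

Lemma Zorn_above (T : Type) (P : set (set T)) (A0 : set T) :
    P A0 ->
    (forall F : set (set T), (exists X, F X) -> (F `<=` P)%classic ->
       total_on F subset -> P (\bigcup_(X in F) X)%classic) ->
  exists A : set T, [/\ P A, (A0 `<=` A)%classic &
    forall B, P B -> (A `<=` B)%classic -> (B `<=` A)%classic].
Proof.
move=> PA0 Pchain.
pose Q (A : set T) := A = set0 \/ (P A /\ (A0 `<=` A)%classic).
have [|A [QA Amax]] := @Zorn_bigcup T Q.
  move=> F FQ Ftot.
  pose F' : set (set T) := fun X => F X /\ P X /\ (A0 `<=` X)%classic.
  have [[X0 F'X0]|noX] := pselect (exists X, F' X); last first.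
    left; rewrite -subset0 => x [X FX Xx].
    by have [X0|X1] := FQ X FX; [rewrite X0 in Xx | case: noX; exists X].
  right; have -> : (\bigcup_(X in F) X = \bigcup_(X in F') X)%classic.
    rewrite eqEsubset; split=> x [X FX Xx]; last by exists X => //; case: FX.
    have [X_0|X1] := FQ X FX; first by rewrite X_0 in Xx.
    by exists X.
  split; last by move=> x A0x; exists X0 => //; case: F'X0 => _ [_]; apply.
  apply: Pchain; [by exists X0 | by move=> X [_ []] | ].
  by move=> X Y [FX _] [FY _]; apply: Ftot.
have Q0 : Q A0 by right; split.
(* If the maximal set is empty then so is [A0], which would otherwise be strictly larger. *)
have [A_0|[PA A0A]] := QA.
  have eqA0 : A0 = set0.
    apply: contrapT => A0n0; apply: (Amax A0) => //; rewrite A_0.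
    by split; [exact: sub0set | rewrite subset0].
  exists A; split; rewrite ?A_0 -?eqA0 // => B PB A0B; apply: contrapT => BnA0.
  apply: (Amax B); first by rewrite A_0 -eqA0; split.
  by right; split.
exists A; split=> // B PB AB; apply: contrapT => BnA.
by apply: (Amax B); [split | right; split=> //; apply: subset_trans AB].
Qed.

Section ChainSubmodule.
Variables (R : pzRingType) (V : lmodType R).

Lemma chain_submodule (F : set (set V)) :
    (exists X, F X) -> (forall X, F X -> is_submodule X) -> total_on F subset ->
  is_submodule (\bigcup_(X in F) X)%classic.
Proof.
move=> [X0 FX0] Fsub Ftot; split.
- by exists X0 => //; apply: submodule0; apply: Fsub.
- move=> x y [X FX Xx] [Y FY Yy].
  have [XY|YX] := Ftot _ _ FX FY.
    by exists Y => //; apply: (submoduleD (Fsub _ FY)) => //; apply: XY.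
  by exists X => //; apply: (submoduleD (Fsub _ FX)) => //; apply: YX.
by move=> r x [X FX Xx]; exists X => //; apply: (submoduleZ (Fsub _ FX)).
Qed.

Definition adjoin (S : V -> Prop) (z : V) : V -> Prop :=
  fun x => exists y r, S y /\ x = y + r *: z.

Lemma adjoin_submodule S z : is_submodule S -> is_submodule (adjoin S z).
Proof.
move=> S_sub; split.
- by exists 0, 0; rewrite scale0r addr0; split=> //; apply: submodule0.
- move=> _ _ [y [r [Sy ->]]] [y' [r' [Sy' ->]]]; exists (y + y'), (r + r').
  by rewrite scalerDl addrACA; split=> //; apply: submoduleD.
move=> t _ [y [r [Sy ->]]]; exists (t *: y), (t * r).
by rewrite scalerDr scalerA; split=> //; apply: submoduleZ.
Qed.

Lemma sub_adjoin (S : V -> Prop) z x : S x -> adjoin S z x.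
Proof. by move=> Sx; exists x, 0; rewrite scale0r addr0. Qed.

Lemma mem_adjoin S z : is_submodule S -> adjoin S z z.
Proof.
by move=> S_sub; exists 0, 1; rewrite scale1r add0r; split=> //; apply: submodule0.
Qed.

End ChainSubmodule.

Definition baer_condition (R : pzRingType) (E : lmodType R) :=
  forall (I : R^o -> Prop) (f : R^o -> E), is_submodule I -> linear_on I f ->
    exists y, forall r, I r -> f r = (r : R) *: y.

Lemma injective_baer (R : pzRingType) (E : lmodType R) :
  injective_module E -> baer_condition E.
Proof.
move=> E_inj I f I_sub f_lin; have [g gE] := injective_extend E_inj I_sub f_lin.
exists (g 1) => r Ir; rewrite -gE // -{1}[r]mulr1.
exact: (linearZ_LR g r 1).
Qed.

(** Zorn's lemma gives a maximal graph of a partial extension. At a point [b], the scalars moving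
    [b] into the domain form a left ideal, and the Baer condition on it provides a value at [b]; so
    the graph is total. *)
Lemma baer (R : pzRingType) (E : lmodType R) :
  baer_condition E -> injective_module E.
Proof.
move=> E_baer A B i i_inj f.
pose functional (G : set (B * E)) := forall e, G (0, e) -> e = 0.
pose P (G : set (B * E)) := is_submodule G /\ functional G.
pose G0 (z : B * E) := exists a, z = (i a, f a).
have G0P : P G0.
  split; first split=> [|_ _ [a ->] [a' ->]|r _ [a ->]].
  - by exists 0; rewrite !linear0.
  - by exists (a + a'); rewrite !linearD.
  - by exists (r *: a); rewrite !linearZ_LR.
  by move=> e [a [ia0 ->]]; rewrite (i_inj a 0) linear0.
have [|G [[G_sub G_fun] G0G Gmax]] := Zorn_above G0P.
  move=> F F0 FP Ftot; split; first by apply: chain_submodule => // X /FP[].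
  by move=> e [X /FP[_]]; apply.
have G_uniq b e e' : G (b, e) -> G (b, e') -> e = e'.
  move=> Gb Gb'; apply/eqP; rewrite -subr_eq0; apply/eqP/G_fun.
  by have : G (b - b, e - e') := submoduleB G_sub Gb Gb'; rewrite subrr.
have G_total b : exists e, G (b, e).
  pose I (r : R^o) := exists e, G ((r : R) *: b, e).
  pose h r := if pselect (I r) is left Ir then projT1 (cid Ir) else 0.
  have hP r : I r -> G ((r : R) *: b, h r).
    by rewrite /h; case: pselect => // Ir _; case: cid.
  have I_sub : is_submodule I.
    split=> [|r r' [e Ge] [e' Ge']|t r [e Ge]].
    - by exists 0; rewrite scale0r; apply: submodule0 G_sub.
    - by exists (e + e'); rewrite scalerDl; apply: (submoduleD G_sub Ge Ge').
    by exists (t *: e); rewrite -scalerA; apply: (submoduleZ G_sub t Ge).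
  have h_lin : linear_on I h.
    split=> [r r' Ir Ir'|t r Ir].
      apply: (@G_uniq (((r : R) + (r' : R)) *: b)).
        exact/hP/(submoduleD I_sub).
      by rewrite scalerDl; apply: (submoduleD G_sub (hP _ Ir) (hP _ Ir')).
    apply: (@G_uniq ((t * (r : R)) *: b)); first exact/hP/(submoduleZ I_sub).
    by rewrite -scalerA; apply: (submoduleZ G_sub t (hP _ Ir)).
  have [y yE] := E_baer I h I_sub h_lin.
  have G'P : P (adjoin G (b, y)).
    split=> [|e [[d e'] [r [Gde' [/= d0 ->]]]]]; first exact: adjoin_submodule.
    have rb : r *: b = - d by apply/eqP; rewrite -addr_eq0 addrC -d0.
    have GN := submoduleN G_sub Gde'.
    have Ir : I r by exists (- e'); rewrite rb.
    by rewrite -yE // (@G_uniq _ _ _ (hP _ Ir) (_ : G (_, - e'))) ?subrr // rb.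
  exists y; apply: Gmax G'P _ _ _; first by move=> z; apply: sub_adjoin.
  exact: mem_adjoin.
have [g gP] := choice G_total.
have g_lin : linear g.
  move=> r x y; apply: (@G_uniq (r *: x + y)); first exact: gP.
  exact: (submoduleD G_sub (submoduleZ G_sub r (gP x)) (gP y)).
exists (linear_fun g_lin) => a /=; apply: (@G_uniq (i a)); first exact: gP.
by apply: G0G; exists a.
Qed.

(** * Flat modules over a quasi-Frobenius ring *)

(** Without a maximal member, the axiom of choice builds a strictly ascending chain by iteration. *)
Lemma noetherian_max (R : pzRingType) (Q : (R^o -> Prop) -> Prop) :
    left_noetherian R -> (forall I, Q I -> is_submodule I) -> (exists I, Q I) ->
  exists2 I, Q I & forall J, Q J -> (forall x, I x -> J x) -> forall x, J x -> I x.
Proof.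
move=> R_noeth Qsub [I0 QI0]; apply: contrapT => nomax.
have step (I : {I : R^o -> Prop | Q I}) : exists J : {I : R^o -> Prop | Q I},
    (forall x, sval I x -> sval J x) /\ ~ (forall x, sval J x -> sval I x).
  case: I => I QI /=; apply: contrapT => noJ; apply: nomax; exists I => // J QJ IJ.
  by apply: contrapT => nJI; apply: noJ; exists (exist _ J QJ).
have [next nextP] := choice step.
pose I n := sval (iter n next (exist _ I0 QI0)).
have [||n nP] := R_noeth I.
- by move=> n; apply: (Qsub (I n)); rewrite /I; case: (iter _ _ _).
- by move=> n x; apply: (nextP (iter n next _)).1.
by apply: (nextP (iter n next (exist _ I0 QI0))).2 => x; apply: (nP n.+1).
Qed.

(** Generation is stated through the submodules containing the generators, so that no linear
    combinations have to be written. *)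
Definition fin_gen (R : pzRingType) (V : lmodType R) (S : V -> Prop) :=
  exists s : seq V, (forall v, v \in s -> S v) /\
    forall T, is_submodule T -> (forall v, v \in s -> T v) -> forall x, S x -> T x.

Definition noetherian_module (R : pzRingType) (V : lmodType R) :=
  forall S : V -> Prop, is_submodule S -> fin_gen S.

Section Noetherian.
Variable R : pzRingType.
Implicit Types U V W : lmodType R.

Lemma zero_submodule V : is_submodule (fun x : V => x = 0).
Proof.
split=> // [x y -> ->|r x ->]; first exact: addr0.
exact: scaler0.
Qed.

(** A maximal finitely generated left ideal inside [S] is all of [S], since adjoining an element
    keeps it finitely generated. *)
Lemma noetherian_regular : left_noetherian R -> noetherian_module (R^o : lmodType R).
Proof.
move=> R_noeth S S_sub.
pose Q J := [/\ is_submodule J, fin_gen J & forall x, J x -> S x].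
have [||J [J_sub [s [sJ Jmin]] JS] Jmax] := @noetherian_max R Q R_noeth.
- by move=> J [].
- exists (fun x => x = 0); split; first exact: zero_submodule.
    by exists [::]; split=> // T T_sub _ _ ->; apply: submodule0.
  by move=> _ ->; apply: submodule0.
suff SJ x : S x -> J x.
  by exists s; split=> [v /sJ/JS //|T T_sub sT x /SJ]; apply: Jmin.
move=> Sx; apply: (Jmax (adjoin J x)); last exact: mem_adjoin; last exact: sub_adjoin.
split; first exact: adjoin_submodule.
  exists (x :: s); split=> [v|T T_sub xsT _ [y [r [Jy ->]]]].
    by rewrite inE => /predU1P[->|/sJ Jv]; [exact: mem_adjoin | exact: sub_adjoin].
  apply: submoduleD => //; last by apply: submoduleZ => //; apply: xsT; apply: mem_head.
  by apply: Jmin Jy => // v vs; apply: xsT; rewrite inE vs orbT.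
by move=> _ [y [r [Jy ->]]]; apply: submoduleD => //; [exact: JS | exact: submoduleZ].
Qed.

(** Lifted generators of [p S] together with generators of the preimage of [S] under [i] generate
    [S]. *)
Lemma noetherian_extension U V W (i : {linear U -> V}) (p : {linear V -> W}) :
    (forall x, p x = 0 -> exists u, i u = x) ->
  noetherian_module U -> noetherian_module W -> noetherian_module V.
Proof.
move=> ker_p U_noeth W_noeth S S_sub.
have im_sub (T : V -> Prop) : is_submodule T ->
    is_submodule (fun w => exists2 v, T v & p v = w).
  move=> T_sub; split=> [|_ _ [v Tv <-] [v' Tv' <-]|r _ [v Tv <-]].
  - by exists 0; [exact: submodule0 | exact: linear0].
  - by exists (v + v'); [exact: submoduleD | exact: linearD].
  by exists (r *: v); [exact: submoduleZ | exact: linearZ_LR].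
have pre_sub (T : V -> Prop) : is_submodule T -> is_submodule (fun u => T (i u)).
  move=> T_sub; split=> [|u u' Tu Tu'|r u Tu].
  - by rewrite linear0; apply: submodule0.
  - by rewrite linearD; apply: submoduleD.
  by rewrite linearZ_LR; apply: submoduleZ.
have [s [sS smin]] := W_noeth _ (im_sub S S_sub).
have [t [tS tmin]] := U_noeth _ (pre_sub S S_sub).
have lift w : exists v, w \in s -> S v /\ p v = w.
  have [/sS[v Sv pv]|ws] := boolP (w \in s); last by exists 0.
  by exists v.
have [l lP] := choice lift.
exists (map l s ++ map i t); split.
  move=> v; rewrite mem_cat => /orP[] /mapP[x xs ->]; last exact: tS.
  by case: (lP _ xs).
move=> T T_sub stT x Sx.
(* The lift [v] of [p x] is taken in both [T] and [S], so that [x - v] stays in [S] and comes from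
   its preimage in [U]. *)
have TS_sub : is_submodule (fun v => T v /\ S v).
  split=> [|v v' [Tv Sv] [Tv' Sv']|r v [Tv Sv]].
  - by split; apply: submodule0.
  - by split; apply: submoduleD.
  by split; apply: submoduleZ.
have [||v [Tv Sv] pv] := smin _ (im_sub _ TS_sub) _ (p x).
- move=> w ws; have [Slw plw] := lP _ ws; exists (l w) => //; split=> //.
  by apply: stT; rewrite mem_cat map_f.
- by exists x.
have [u iu] : exists u, i u = x - v by apply: ker_p; rewrite linearB pv subrr.
rewrite -(subrK v x) -iu; apply: submoduleD => //.
apply: (tmin _ (pre_sub T T_sub)); last by rewrite iu; apply: submoduleB.
by move=> u' u't; apply: stT; rewrite mem_cat map_f ?orbT.
Qed.

Lemma noetherian_free n :
  left_noetherian R -> noetherian_module ({ffun 'I_n -> R^o} : lmodType R).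
Proof.
move=> R_noeth; elim: n => [|n IHn].
  move=> S S_sub; exists [::]; split=> // T T_sub _ x _.
  have -> : x = 0 by apply/ffunP => -[].
  exact: submodule0.
pose i_fun (u : {ffun 'I_n -> R^o}) : {ffun 'I_n.+1 -> R^o} :=
  [ffun k => if unlift ord0 k is Some j then u j else 0].
have i_lin : linear i_fun.
  move=> r u v; apply/ffunP => k; rewrite !ffunE.
  by case: unlift => [j|]; rewrite ?ffunE // scaler0 addr0.
have p_lin : linear (fun v : {ffun 'I_n.+1 -> R^o} => v ord0).
  by move=> r u v; rewrite !ffunE.
apply: (@noetherian_extension _ _ _ (linear_fun i_lin) (linear_fun p_lin)) IHn _;
  last exact: noetherian_regular.
move=> x x0; exists [ffun j => x (fintype.lift ord0 j)].
apply/ffunP => k; rewrite !ffunE.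
by case: unliftP => [j ->|->]; rewrite ?ffunE.
Qed.

(* A linear map from a (finitely presented) left ideal to a flat module factors
   through a finite free module, to which injectivity of the ring applies. *)
Lemma qF_eq_flat_injective (F : lmodType R) :
  quasi_Frobenius R -> eq_flat F -> injective_module F.
Proof.
move=> [R_noeth R_inj] F_flat; apply: baer => I f I_sub f_lin.
have [s [sI smin]] := noetherian_regular R_noeth I_sub.
pose n := size s; pose x (i : 'I_n) : R := tnth (in_tuple s) i.
have Ix i : I (x i) by apply/sI/mem_tnth.
have genI r : I r -> exists t : 'I_n -> R, r = \sum_i t i * x i.
  apply: (smin (fun r => exists t : 'I_n -> R, r = \sum_i t i * x i)) => [|v vs].
    split=> [|_ _ [t ->] [t' ->]|c _ [t ->]].
    - by exists (fun=> 0); rewrite big1 // => i _; rewrite mul0r.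
    - exists (fun i => t i + t' i); rewrite -big_split.
      by apply: eq_bigr => i _; rewrite mulrDl.
    exists (fun i => c * t i); rewrite scaler_sumr.
    by apply: eq_bigr => i _; rewrite -mulrA.
  have /tnthP[i vE] : v \in in_tuple s by [].
  exists (fun i' => (i' == i)%:R); rewrite (bigD1 i) //= eqxx mul1r big1 ?addr0 //.
  by move=> i' /negPf ->; rewrite mul0r.
have fE (t : 'I_n -> R) : f (\sum_i t i * x i) = \sum_i t i *: f (x i).
  rewrite (linear_on_sum _ I_sub f_lin); last by move=> i _; apply: submoduleZ.
  by apply: eq_bigr => i _; apply: f_lin.2.
pose L (t : {ffun 'I_n -> R^o}) := \sum_i (t i : R) * x i = 0.
have L_sub : is_submodule L.
  split=> [|t t' Lt Lt'|c t Lt]; rewrite /L.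
  - by rewrite big1 // => i _; rewrite ffunE mul0r.
  - under eq_bigr do rewrite ffunE mulrDl.
    by rewrite big_split /= Lt Lt' addr0.
  under eq_bigr do rewrite ffunE -mulrA.
  by rewrite -mulr_sumr Lt mulr0.
(* Finite presentation of [I]: finitely many relations between its generators generate all of
   them. *)
have [rel [relL relmin]] := noetherian_free R_noeth L_sub.
have [|K [y [c [fxE ac0]]]] := F_flat _ _ (fun i => f (x i))
    (fun (j : 'I_(size rel)) i => tnth (in_tuple rel) j i).
  move=> j; rewrite -fE relL ?mem_tnth //.
  rewrite -[X in f X](scale0r (0 : R^o)) f_lin.2 ?scale0r //.
  exact: submodule0 I_sub.
have Lc (t : 'I_n -> R) k : \sum_i t i * x i = 0 -> \sum_i t i * c i k = 0.
  move=> tx0; pose T (t : {ffun 'I_n -> R^o}) := \sum_i (t i : R) * c i k = 0.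
  have : T [ffun i => t i].
    apply: (relmin T); last first.
    - by rewrite /L -[RHS]tx0; apply: eq_bigr => i _; rewrite ffunE.
    - move=> v vs; have /tnthP[j vE] : v \in in_tuple rel by [].
      by rewrite /T vE; apply: ac0.
    split=> [|u u' Tu Tu'|d u Tu]; rewrite /T.
    - by rewrite big1 // => i _; rewrite ffunE mul0r.
    - under eq_bigr do rewrite ffunE mulrDl.
      by rewrite big_split /= Tu Tu' addr0.
    under eq_bigr do rewrite ffunE -mulrA.
    by rewrite -mulr_sumr Tu mulr0.
  by rewrite /T; under eq_bigr do rewrite ffunE.
have Lc2 (t t' : 'I_n -> R) k : \sum_i t i * x i = \sum_i t' i * x i ->
    \sum_i t i * c i k = \sum_i t' i * c i k.
  move=> tt'; apply/eqP; rewrite -subr_eq0 -sumrB.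
  under eq_bigr do rewrite -mulrBl; apply/eqP/Lc.
  by under eq_bigr do rewrite mulrBl; rewrite sumrB tt' subrr.
have [t tE] : exists t : R -> 'I_n -> R, forall r, I r -> r = \sum_i t r i * x i.
  have tot r : exists t : 'I_n -> R, I r -> r = \sum_i t i * x i.
    by have [/genI[t tE]|nIr] := pselect (I r); [exists t | exists (fun=> 0)].
  by have [t tP] := choice tot; exists t.
(* By [Lc2] there is a well-defined map from [I] to [R] sending [x i] to [c i k]; as [R] is
   injective, it is right multiplication by some [w]. *)
have ext k : exists w : R, forall i, c i k = x i * w.
  pose g (r : R^o) : R^o := \sum_i t r i * c i k.
  have [||w wE] := injective_baer R_inj (I := I) (f := g) => //.
    split=> [r r' Ir Ir'|d r Ir]; rewrite /g.
      rewrite -big_split /=; under [RHS]eq_bigr do rewrite -mulrDl; apply: Lc2.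
      under [RHS]eq_bigr do rewrite mulrDl; rewrite big_split /= -!tE //.
      exact: submoduleD.
    rewrite -[RHS]/((d : R) * \sum_i t r i * c i k) mulr_sumr.
    under [RHS]eq_bigr do rewrite mulrA; apply: Lc2.
    under [RHS]eq_bigr do rewrite -mulrA; rewrite -mulr_sumr -!tE //.
    exact: submoduleZ.
  exists w => i; rewrite -[RHS]wE // /g.
  transitivity (\sum_i' (i' == i)%:R * c i' k).
    rewrite (bigD1 i) //= eqxx mul1r big1 ?addr0 // => i' /negPf ->.
    by rewrite mul0r.
  apply: Lc2; rewrite -tE // (bigD1 i) //= eqxx mul1r big1 ?addr0 // => i' /negPf ->.
  by rewrite mul0r.
have [w wE] := choice ext.
exists (\sum_k w k *: y k) => r Ir; rewrite {1}(tE r Ir) fE {2}(tE r Ir) scaler_suml.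
apply: eq_bigr => i _; rewrite -scalerA; congr (_ *: _).
by rewrite fxE scaler_sumr; apply: eq_bigr => k _; rewrite wE scalerA.
Qed.

End Noetherian.

(** * Free precovers *)

(** A flat [F'] is a direct summand of [R^(F')], and a map on [R^(F')] lifts by choosing images of
    the basis elements. *)
Lemma free_flat_precover (R : pzRingType) (N : lmodType R) :
    (forall V : lmodType R, eq_flat V -> injective_module V) ->
  flat_precover (free_lift (@id N)).
Proof.
move=> flat_inj; split=> [|F' F'_flat u]; first exact/eq_flat_flat/eq_flat_free.
have [s sE] : exists s : {linear F' -> free_module R F'},
    forall z, free_lift id (s z) = z.
  apply: eq_flat_split => //; [|exact: eq_flat_free | exact: flat_eq_flat].
  by move=> z; exists (free_gen R z); rewrite free_lift_gen.
exists (free_lift (fun x => free_gen R (u x)) \o s) => x.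
rewrite -[RHS]/(u x) -[in RHS](sE x) free_lift_comp -[LHS]/(free_lift id _).
rewrite free_lift_comp; congr (free_lift _ _ : N); apply/funext => z.
by rewrite free_lift_gen.
Qed.

(** * Injective modules cogenerate *)

Lemma int_ideal_principal (I : int^o -> Prop) : is_submodule I ->
  exists2 n : nat, I n%:Z & forall k, I k -> exists m : int, k = m * n%:Z.
Proof.
move=> I_sub.
have [ex_pos|no_pos] := pselect (exists n : nat, `[< I n.+1%:Z >]); last first.
  exists 0%N => [|k Ik]; first exact: submodule0 I_sub.
  exists 0; rewrite mul0r; apply: contrapT => k0; apply: no_pos.
  case: k Ik k0 => [[|n]|n] Ik k0 //; exists n; apply/asboolP => //.
  by rewrite -[Posz _]opprK -NegzE; apply: (submoduleN I_sub Ik).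
case: (ex_minnP ex_pos) => n /asboolP In nmin; exists n.+1 => // k Ik.
exists (k %/ n.+1)%Z; rewrite {1}(divz_eq k n.+1).
suff -> : (k %% n.+1)%Z = 0 by rewrite addr0.
have Imod : I (k %% n.+1)%Z.
  exact: (submoduleB I_sub Ik (submoduleZ I_sub (k %/ n.+1)%Z In)).
have : (k %% n.+1)%Z < n.+1%:Z by exact: ltz_pmod.
have : 0 <= (k %% n.+1)%Z by exact: modz_ge0.
case: (k %% n.+1)%Z Imod => // -[//|m] Im _; rewrite ltz_nat ltnS => ltmn.
by have := nmin m (introT (asboolP _) Im); rewrite leqNgt ltmn.
Qed.

Lemma zmod_linear (A B : zmodType) (f : A -> B) : {morph f : x y / x + y} ->
  linear (f : zmodule A -> zmodule B).
Proof.
move=> fD k x y; rewrite [LHS]fD; congr (_ + _).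
have f0 : f 0 = 0 by apply: (addrI (f 0)); rewrite -fD !addr0.
have fN z : f (- z) = - f z by apply: (addrI (f z)); rewrite -fD !subrr.
have fn z n : f (z *+ n) = f z *+ n.
  by elim: n => [|n IHn]; rewrite ?mulr0n // !mulrS fD IHn.
by case: k => n; [exact: fn | rewrite NegzE !scaleNr [LHS]fN; congr (- _); exact: fn].
Qed.

Lemma divisible_injective (D : zmodType) :
    (forall (n : nat) (d : D), exists d', d' *+ n.+1 = d) ->
  injective_module (zmodule D : lmodType int).
Proof.
move=> D_div; apply: baer => I f I_sub [fD fZ].
have [n In nP] := int_ideal_principal I_sub.
have [y yE] : exists y : zmodule D, f n%:Z = n%:Z *: y.
  case: n In {nP} => [|n] In; last by have [y <-] := D_div n (f n.+1%:Z); exists y.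
  by exists 0; rewrite -[X in f X](scale0r (0 : int^o)) fZ ?scaler0 ?scale0r.
by exists y => k /nP[m ->]; rewrite [LHS]fZ // yE scalerA.
Qed.

Definition int_rat : {pred rat} := fun r => r \is a Num.int.

Fact int_rat_zmod_closed : zmod_closed int_rat.
Proof. by split=> [|x y]; [exact: rpred0 | exact: rpredB]. Qed.

HB.instance Definition _ := GRing.isZmodClosed.Build rat int_rat int_rat_zmod_closed.

Definition rat_mod_int : zmodType := Quotient.quot int_rat.

Lemma rat_mod_int_eq0 (r : rat) :
  (\pi_(Quotient.quot int_rat)%qT r = 0 :> rat_mod_int) <-> r \is a Num.int.
Proof.
have := Quotient.idealrBE int_rat r 0; rewrite subr0 raddf0.
by move=> ->; split=> [->|/eqP].
Qed.

Lemma rat_mod_int_divisible (n : nat) (d : rat_mod_int) : exists d', d' *+ n.+1 = d.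
Proof.
exists (\pi_(Quotient.quot int_rat)%qT (repr d / n.+1%:R)).
have divK : (repr d / n.+1%:R) *+ n.+1 = repr d :> rat.
  by rewrite -[LHS]mulr_natr divfK // pnatr_eq0.
by rewrite -raddfMn divK; apply: reprK.
Qed.

Lemma rat_mod_int_character (I : int^o -> Prop) : is_submodule I -> ~ I 1 ->
  exists2 q : rat_mod_int, q <> 0 & forall k, I k -> q *~ k = 0.
Proof.
move=> I_sub nI1; have [n In nP] := int_ideal_principal I_sub.
(* The character is the class of [1/n]; if [I] is zero any nonzero class would do, and [1/2] is
   taken. *)
pose m := if n == 0%N then 2%N else n.
have m_gt1 : (1 < m)%N.
  by rewrite /m; case: n In {nP m} => [|[|n]] // /nI1.
exists (\pi_(Quotient.quot int_rat)%qT (m%:R^-1)).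
  move=> /rat_mod_int_eq0 /intrP[k mk].
  have : (m%:R : rat) * m%:R^-1 = 1 by rewrite divff // pnatr_eq0 -lt0n ltnW.
  rewrite mk => /eqP; rewrite -[m%:R]/(m%:Z%:~R) -intrM -[1]/(1%:~R) eqr_int.
  move=> /eqP/(congr1 absz); rewrite abszM /= => /eqP; rewrite muln_eq1.
  by rewrite gtn_eqF.
move=> k /nP[c ->]; rewrite -raddfMz; apply/rat_mod_int_eq0.
rewrite -mulrzr intrM.
have -> : (n%:Z%:~R : rat) = (n == m)%:R * m%:R.
  rewrite /m; case: n {In nP m m_gt1} => [|n] /=; first by rewrite mul0r.
  by rewrite eqxx mul1r.
rewrite mulrC -!mulrA divff ?pnatr_eq0 -?lt0n 1?ltnW // mulr1.
by rewrite rpredM ?rpred_nat // intr_int.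
Qed.

(** * The coinduced module of additive maps from [R] to [D] *)

Section Coinduced.
Variables (R : pzRingType) (D : zmodType).

Definition additive_pred : {pred R -> D} :=
  fun h => `[< {morph h : x y / x + y} >].

Fact additive_pred_closed : zmod_closed additive_pred.
Proof.
split=> [|g h /asboolP gD /asboolP hD]; apply/asboolP => x y.
  by rewrite [RHS]addr0.
by rewrite [LHS](congr2 (fun a b => a - b) (gD x y) (hD x y)) opprD addrACA.
Qed.
HB.instance Definition _ :=
  GRing.isZmodClosed.Build (R -> D) additive_pred additive_pred_closed.

Record coinduced := Coinduced {
  coind_val :> R -> D; coind_valP : coind_val \in additive_pred }.
HB.instance Definition _ := [isSub for coind_val].
HB.instance Definition _ := [Choice of coinduced by <:].
HB.instance Definition _ := [SubChoice_isSubZmodule of coinduced by <:].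

Lemma coindD (h : coinduced) : {morph h : x y / x + y}.
Proof. exact/asboolP/coind_valP. Qed.

Definition coind (h : R -> D) (hD : {morph h : x y / x + y}) : coinduced :=
  @Coinduced h (introT (asboolP _) hD).

Lemma coind_ext (g h : coinduced) : g =1 h -> g = h.
Proof. by move=> /funext gh; apply: val_inj. Qed.

Fact coind_scale_add (t : R) (h : coinduced) :
  {morph (fun r => h (r * t)) : x y / x + y}.
Proof. by move=> x y; rewrite mulrDl coindD. Qed.

Definition coind_scale t h := coind (coind_scale_add t h).

Fact coind_scaleA a b h : coind_scale a (coind_scale b h) = coind_scale (a * b) h.
Proof. by apply: coind_ext => r /=; rewrite mulrA. Qed.
Fact coind_scale1 : left_id 1 coind_scale.
Proof. by move=> h; apply: coind_ext => r /=; rewrite mulr1. Qed.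
Fact coind_scaleDr : right_distributive coind_scale +%R.
Proof. by move=> t g h; apply: coind_ext. Qed.
Fact coind_scaleDl h : {morph coind_scale^~ h : a b / a + b}.
Proof. by move=> a b; apply: coind_ext => r /=; rewrite mulrDr coindD. Qed.

HB.instance Definition _ := GRing.Zmodule_isLmodule.Build R coinduced
  coind_scaleA coind_scale1 coind_scaleDr coind_scaleDl.

(* Adjunction: linear maps to the coinduced module are additive maps to [D]. *)
Lemma coinduced_injective :
    injective_module (zmodule D : lmodType int) ->
  injective_module (coinduced : lmodType R).
Proof.
move=> D_inj A B i i_inj f.
have iz_lin : linear (i : zmodule A -> zmodule B) by apply/zmod_linear/linearD.
have fz_lin : linear ((fun a => f a 1) : zmodule A -> zmodule D).
  by apply: zmod_linear => a a'; rewrite linearD.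
have [g gE] := D_inj _ _ (linear_fun iz_lin) i_inj (linear_fun fz_lin).
have gD (x y : B) : g (x + y) = g x + g y :> D by exact: linearD.
have h_add (b : B) : {morph ((fun r : R => g (r *: b)) : R -> D) : x y / x + y}.
  by move=> r r'; rewrite scalerDl gD.
have h_lin : linear (fun b => coind (h_add b)).
  by move=> r x y; apply: coind_ext => s /=; rewrite scalerDr gD scalerA.
exists (linear_fun h_lin) => a; apply: coind_ext => r /=.
rewrite -linearZ_LR; apply: etrans (gE (r *: a)) _ => /=.
by rewrite linearZ_LR /= mul1r.
Qed.

End Coinduced.

(** On the subgroup [P + Z y] the rule [p + k y |-> k q] is well defined when [q] is killed by every
    [k] with [k y] in [P]; it extends to [V] because Q/Z is injective over the integers. *)
Lemma character_exists (R : pzRingType) (V : lmodType R) (P : V -> Prop) (y : V) :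
    is_submodule P -> ~ P y ->
  exists chi : V -> rat_mod_int,
    [/\ {morph chi : u v / u + v}, forall u, P u -> chi u = 0 & chi y <> 0].
Proof.
move=> P_sub nPy; pose I (k : int^o) := P (y *~ k).
have I_sub : is_submodule I.
  split=> [|k l Ik Il|c k Ik]; rewrite /I.
  - by rewrite mulr0z; apply: submodule0.
  - by rewrite mulrzDr; apply: submoduleD.
  rewrite -[X in P (y *~ X)]/((c : int) * k) mulrC mulrzA -scaler_int.
  exact: submoduleZ.
have nI1 : ~ I 1 by rewrite /I mulr1z.
have [q q_neq0 qI] := rat_mod_int_character I_sub nI1.
pose S (v : zmodule V) := exists p k, P p /\ v = p + y *~ k.
have S_sub : is_submodule S.
  split=> [|_ _ [p [k [Pp ->]]] [p' [k' [Pp' ->]]]|c _ [p [k [Pp ->]]]].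
  - by exists 0, 0; split; [exact: submodule0 P_sub | rewrite mulr0z addr0].
  - exists (p + p'), (k + k'); split; first exact: submoduleD.
    by rewrite mulrzDr [LHS]addrACA.
  exists (p *~ c), (k * c); split; first by rewrite -scaler_int; apply: submoduleZ.
  by rewrite mulrzA -mulrzDl.
have [f fP] : exists f : zmodule V -> zmodule rat_mod_int,
    forall p k, P p -> f (p + y *~ k) = q *~ k.
  have tot (v : zmodule V) : exists d : zmodule rat_mod_int,
      forall p k, P p -> v = p + y *~ k -> d = q *~ k.
    have [[p [k [Pp ->]]]|nS] := pselect (S v); last first.
      by exists 0 => p k Pp vE; case: nS; exists p, k.
    exists (q *~ k) => p' k' Pp' eq_pk; apply/eqP; rewrite -subr_eq0 -mulrzBr.
    apply/eqP/qI; rewrite /I mulrzBr.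
    have -> : y *~ k - y *~ k' = p' - p.
      apply/eqP; rewrite subr_eq addrAC -eq_pk addrC addKr //.
    exact: submoduleB.
  by have [f fP] := choice tot; exists f => p k Pp; apply: fP Pp erefl.
have f_lin : linear_on S f.
  split=> [_ _ [p [k [Pp ->]]] [p' [k' [Pp' ->]]]|c _ [p [k [Pp ->]]]].
    rewrite [X in f X](_ : _ = (p + p') + y *~ (k + k')).
      by rewrite !fP ?mulrzDr //; apply: submoduleD.
    by rewrite mulrzDr [LHS]addrACA.
  rewrite [X in f X](_ : _ = p *~ c + y *~ (k * c)).
    by rewrite !fP ?mulrzA // -scaler_int; apply: submoduleZ.
  by rewrite mulrzA -mulrzDl.
have [chi chiE] :=
  injective_extend (divisible_injective rat_mod_int_divisible) S_sub f_lin.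
exists chi; split.
- by move=> u v; apply: (linearD chi u v).
- move=> u Pu; have uE : u = u + y *~ 0 by rewrite mulr0z addr0.
  by rewrite chiE; [rewrite [X in f X]uE fP // mulr0z | exists u, 0].
have yE : y = 0 + y *~ 1 by rewrite mulr1z add0r.
have P0 := submodule0 P_sub.
by rewrite chiE; [rewrite [X in f X]yE fP // mulr1z | exists 0, 1].
Qed.

(** One module serves all [x] at once: [D] is a power of Q/Z with one coordinate for each [y] in
    [V], carrying a character that kills [P x] and detects [y] outside it. *)
Lemma injective_cogenerators (R : pzRingType) (V : lmodType R) (X : Type)
    (P : X -> V -> Prop) : (forall x, is_submodule (P x)) ->
  exists2 E : lmodType R, injective_module E &
    exists phi : X -> {linear V -> E}, forall x v, phi x v = 0 <-> P x v.
Proof.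
move=> P_sub; pose D : zmodType := V -> rat_mod_int.
have D_div n (d : D) : exists d', d' *+ n.+1 = d.
  have [d' d'E] := choice (fun v => rat_mod_int_divisible n (d v)).
  exists d'; apply/funext => v; rewrite -d'E.
  by elim: n.+1 => [//|m IHm]; rewrite !mulrS -IHm.
exists (coinduced R D : lmodType R).
  exact/coinduced_injective/divisible_injective.
have tot (xy : X * V) : exists chi : V -> rat_mod_int,
    [/\ {morph chi : u v / u + v}, forall u, P xy.1 u -> chi u = 0 &
      ~ P xy.1 xy.2 -> chi xy.2 <> 0].
  have [Py|nPy] := pselect (P xy.1 xy.2).
    by exists (fun=> 0); split=> // u v; rewrite addr0.
  by have [chi [chiD chiP chiy]] := character_exists (P_sub xy.1) nPy; exists chi.
have [chi chiP] := choice tot.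
have phi_add x v : {morph ((fun r y => chi (x, y) (r *: v)) : R -> D) : r s / r + s}.
  move=> r s; apply/funext => y; have [chiD _ _] := chiP (x, y).
  by rewrite scalerDl chiD.
have phi_lin x : linear (fun v => coind (phi_add x v)).
  move=> r u v; apply: coind_ext => s; apply/funext => y /=.
  by have [chiD _ _] := chiP (x, y); rewrite scalerDr chiD scalerA.
exists (fun x => linear_fun (phi_lin x)) => x v; split=> [phi0|Pv].
  apply: contrapT => nPv; have [_ _ /(_ nPv)] := chiP (x, v); apply=> /=.
  have /(congr1 (fun h => h (1 : R) v)) /= := congr1 (@coind_val R D) phi0.
  by rewrite scale1r.
apply: coind_ext => r; apply/funext => y /=.
by have [_ chi0 _] := chiP (x, y); apply: chi0; apply: submoduleZ.
Qed.

(** * The condition on domains forces the ring to be quasi-Frobenius *)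

Section Converse.
Variable R : pzRingType.
Hypothesis domains : forall M N : lmodType R,
  flat_precover_completing_domain M N <-> subinjectivity_domain N M.

(** Flat precovers lift every map out of a flat [F], so [F] lies in its own subinjectivity domain
    and splits off an injective module containing it. *)
Lemma domains_flat_injective (F : lmodType R) : eq_flat F -> injective_module F.
Proof.
move=> /eq_flat_flat F_flat.
have F_sub : subinjectivity_domain F F.
  by apply/domains => f G g [_]; apply.
have [E E_inj [phi phi0]] := injective_cogenerators (fun _ : unit => zero_submodule F).
have phi_inj : injective (phi tt).
  move=> x y eq_xy; apply/eqP; rewrite -subr_eq0; apply/eqP/(phi0 tt).
  by rewrite linearB eq_xy subrr.
have [r rE] := F_sub _ _ phi_inj
  (linear_fun (fun c x y => erefl (c *: x + y) : _ = _ :> F)).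
move=> A B i i_inj f; have [g gE] := E_inj _ _ _ i_inj (phi tt \o f).
by exists (r \o g) => a /=; rewrite [g (i a)]gE; apply: rE.
Qed.

(** An injective [E] lies in its own subinjectivity domain, so its identity lifts along the free
    cover. *)
Lemma domains_injective_flat (E : lmodType R) : injective_module E -> eq_flat E.
Proof.
move=> E_inj.
have /domains E_dom : subinjectivity_domain E E by move=> K i i_inj f; apply: E_inj.
have [h hE] := E_dom (linear_fun (fun c x y => erefl (c *: x + y) : _ = _ :> E)) _ _
  (free_flat_precover E domains_flat_injective).
exact: (eq_flat_retract hE (@eq_flat_free R E)).
Qed.

(* Bass-Papp: extend [r |-> (r mod I n)_n] from the union of the chain to [R]. *)
Lemma domains_quasi_Frobenius : quasi_Frobenius R.
Proof.
split; last exact/domains_flat_injective/eq_flat_regular.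
move=> I I_ideal I_chain.
have I_mono m n x : (m <= n)%N -> I m x -> I n x.
  by move=> /subnK <- Imx; elim: (n - m)%N => [//|k IHk]; apply: I_chain.
have [E E_inj [phi phiP]] := injective_cogenerators
  (V := (R^o : lmodType R)) (P := I) (fun n => I_ideal n).
pose W := finsupp nat E.
have W_inj : injective_module W.
  exact/domains_flat_injective/eq_flat_finsupp/domains_injective_flat.
pose U (r : R^o) := exists n, I n r.
have U_sub : is_submodule U.
  split=> [|r s [m Im] [n In]|t r [n In]].
  - by exists 0%N; have [] := I_ideal 0%N.
  - exists (maxn m n); have [_ + _] := I_ideal (maxn m n); apply.
      by apply: I_mono Im; apply: leq_maxl.
    by apply: I_mono In; apply: leq_maxr.
  by exists n; have [_ _] := I_ideal n; apply.
have fs r : U r -> finsupp_fun (fun n => phi n r).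
  move=> [m Im]; exists (iota 0 m) => n; rewrite mem_iota /= add0n -leqNgt => mn.
  by apply/phiP/(I_mono m).
have [f fE] : exists f : R^o -> W, forall r, U r -> fseval (f r) = (fun n => phi n r).
  have tot r : exists w : W, U r -> fseval w = (fun n => phi n r).
    have [Ur|nUr] := pselect (U r); last by exists 0.
    by exists (submod_in (finsupp_submodule nat E) (fs r Ur)).
  by have [f fP] := choice tot; exists f.
have f_lin : linear_on U f.
  split=> [r s Ur Us|t r Ur]; apply: fsext => n.
    by rewrite fsevalD !fE ?linearD //; apply: submoduleD.
  by rewrite fsevalZ !fE ?linearZ_LR //; apply: submoduleZ.
have [w wE] := injective_baer W_inj U_sub f_lin.
have [s _ ws] := finsuppP w.
(* Coordinate [n] is outside the support of [w], so [phi n] vanishes on the whole union, which is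
   therefore [I n]. *)
pose n := (\max_(k <- s) k).+1.
have ns : n \notin s.
  by apply/negP => /(@leq_bigmax_seq _ s predT id n)/(_ isT); rewrite ltnn.
exists n => m x _ Imx; apply/(phiP n); have Ux : U x by exists m.
by have := congr1 (@fseval _ _ _ ^~ n) (wE x Ux); rewrite fE // fsevalZ ws // scaler0.
Qed.

End Converse.

(** * Simple submodules over a quasi-Frobenius ring *)

(* [m] generates a simple submodule. *)
Definition simple_elt (R : pzRingType) (M : lmodType R) (m : M) :=
  m <> 0 /\ forall t : R, t *: m <> 0 -> exists s : R, s *: (t *: m) = m.

(** The annihilator of the whole submodule [R m], which makes it a two-sided ideal. *)
Definition annihilator (R : pzRingType) (M : lmodType R) (m : M) : R -> Prop :=
  fun r => forall s : R, r *: (s *: m) = 0.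

(** * Two-sided ideals and minimal one-sided ideals modulo a prime *)

Definition two_sided (R : pzRingType) (P : R -> Prop) :=
  [/\ P 0, forall x y, P x -> P y -> P (x + y),
      forall r x, P x -> P (r * x) & forall r x, P x -> P (x * r)].

Section TwoSided.
Variables (R : pzRingType) (P : R -> Prop).
Hypothesis P_ideal : two_sided P.

Lemma two_sidedD x y : P x -> P y -> P (x + y).
Proof. by case: P_ideal => _ + _ _; apply. Qed.
Lemma two_sidedMl r x : P x -> P (r * x).
Proof. by case: P_ideal => _ _ + _; apply. Qed.
Lemma two_sidedMr r x : P x -> P (x * r).
Proof. by case: P_ideal => _ _ _; apply. Qed.
Lemma two_sidedN x : P x -> P (- x).
Proof. by rewrite -mulN1r; apply: two_sidedMl. Qed.

Lemma two_sided_submodule : is_submodule (P : R^o -> Prop).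
Proof. by case: P_ideal. Qed.

Definition cong (x y : R) := P (x - y).

Lemma cong_refl x : cong x x.
Proof. by rewrite /cong subrr; case: P_ideal. Qed.
Lemma cong_sym x y : cong x y -> cong y x.
Proof. by rewrite /cong -opprB; move/two_sidedN; rewrite opprK. Qed.
Lemma cong_trans y x z : cong x y -> cong y z -> cong x z.
Proof. by move=> xy yz; have := two_sidedD xy yz; rewrite addrA subrK. Qed.
Lemma congMl r x y : cong x y -> cong (r * x) (r * y).
Proof. by rewrite /cong -mulrBr; apply: two_sidedMl. Qed.
Lemma congMr r x y : cong x y -> cong (x * r) (y * r).
Proof. by rewrite /cong -mulrBl; apply: two_sidedMr. Qed.
Lemma cong_mem x y : cong x y -> P y -> P x.
Proof. by move=> xy Py; rewrite -(subrK y x); apply: two_sidedD. Qed.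

(* Modulo a prime ideal, a minimal right ideal is generated by an idempotent [e],
   and then [e] also generates a minimal left ideal. *)
Lemma prime_minimal_left :
    (forall a b, ~ P a -> ~ P b -> exists r, ~ P (a * r * b)) ->
    (exists2 a, ~ P a & forall t, ~ P (a * t) -> exists s, cong (a * t * s) a) ->
  exists2 e, ~ P e & forall t, ~ P (t * e) -> exists v, cong (v * t * e) e.
Proof.
move=> P_prime [a nPa a_min].
(* Primeness yields [c] in [a R] with [c a] outside [P]; by minimality, left multiplication by [c]
   is injective on [a R] modulo [P]. *)
have [u nPc] := P_prime a a nPa nPa; set c := a * u in nPc *.
have [w caw] : exists w, cong (c * a * w) a.
  by rewrite /c -mulrA; apply: a_min; rewrite mulrA.
have c_inj z : P (c * (a * z)) -> P (a * z).
  move=> Pcaz; apply: contrapT => nPaz; have [s azs] := a_min z nPaz.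
  apply: nPc; apply: (cong_mem (cong_sym (congMl c azs))).
  by rewrite mulrA; apply: two_sidedMr.
pose e := a * w * u.
have ce : cong (c * e) c by rewrite /e !mulrA; apply: congMr.
(* The difference [e * e - e] lies in [a R] and is killed by [c] modulo [P]. *)
have ee : cong (e * e) e.
  have -> : e * e = a * (w * u * e) by rewrite /e !mulrA.
  rewrite /cong {2}/e -[a * w * u]mulrA -mulrBr; apply: c_inj.
  rewrite !mulrBr [a * (_ * e)]mulrA [a * (w * u)]mulrA -/e.
  by rewrite [c * (e * e)]mulrA; apply: congMr.
have nPe : ~ P e.
  move=> Pe; apply: nPc; apply: (cong_mem (cong_sym (congMr a ce))).
  by apply: two_sidedMr; apply: two_sidedMl.
have e_min t : ~ P (e * t) -> exists s, cong (e * t * s) e.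
  move=> nPet; have [|s es] := a_min (w * u * t); first by rewrite !mulrA.
  exists (s * w * u); move: (congMr u (congMr w es)); rewrite -/e.
  by rewrite /e !mulrA.
clearbody e; exists e => // t nPte; have [v nPd] := P_prime e (t * e) nPe nPte.
(* Inversion in [e R e] modulo [P]: [y] is a right inverse of [d] and [y2] one of [y], so [d] agrees
   with [y2] and [y] is also a left inverse. *)
pose d := e * (v * t * e).
have dE : d = e * v * (t * e) by rewrite /d !mulrA.
have [|s ds] := e_min (v * t * e); first by rewrite -/d dE.
have de : cong (d * e) d.
  by rewrite /d -!mulrA; do 3!apply: congMl; apply: ee.
pose y := e * (s * e).
have dy : cong (d * y) e.
  apply: (cong_trans (y := d * s * e)).
    by rewrite /y !mulrA -!(mulrA _ s e); apply: congMr; apply: de.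
  by apply: cong_trans (congMr e ds) ee.
have nPy : ~ P y by move=> Py; apply/nPe/(cong_mem (cong_sym dy))/two_sidedMl.
have [s2 ys2] := e_min (s * e) nPy.
pose y2 := e * (s2 * e).
have yy2 : cong (y * y2) e.
  apply: (cong_trans (y := y * s2 * e)).
    rewrite /y2 /y !mulrA -!(mulrA _ s2 e); apply: congMr.
    by rewrite -!mulrA; do 2!apply: congMl; apply: ee.
  by apply: cong_trans (congMr e ys2) ee.
have dy2 : cong d y2.
  apply: cong_trans (cong_sym de) _; apply: cong_trans (congMl d (cong_sym yy2)) _.
  rewrite mulrA; apply: cong_trans (congMr y2 dy) _.
  by rewrite /y2 mulrA; apply: congMr.
exists (y * e * v); apply: cong_trans _ yy2.
have -> : y * e * v * t * e = y * d by rewrite /d !mulrA.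
exact: congMl.
Qed.

End TwoSided.

Lemma annihilator_two_sided (R : pzRingType) (M : lmodType R) (m : M) :
  two_sided (annihilator m).
Proof.
split=> [s|x y Ax Ay s|r x Ax s|r x Ax s].
- by rewrite scale0r.
- by rewrite scalerDl Ax Ay addr0.
- by rewrite -scalerA Ax scaler0.
by rewrite -scalerA (scalerA r) Ax.
Qed.

(** * Double annihilators, simple submodules and chain conditions *)

Section QuasiFrobenius.
Variable R : pzRingType.
Hypotheses (R_noeth : left_noetherian R) (R_inj : injective_module (R^o : lmodType R)).

(* [r (l K) = K] for a finitely generated right ideal [K]. *)
Lemma right_double_annihilator n (x : 'I_n -> R) (y : R) :
    (forall t, (forall i, t * x i = 0) -> t * y = 0) ->
  exists w : 'I_n -> R, y = \sum_i x i * w i.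
Proof.
move=> xy; pose V : lmodType R := {ffun 'I_n -> R^o}.
pose v (t : R) : V := [ffun i => t * x i].
pose S (z : V) := exists t, z = v t.
have vD t t' : v (t + t') = v t + v t' by apply/ffunP => i; rewrite !ffunE mulrDl.
have vZ r t : v (r * t) = r *: v t by apply/ffunP => i; rewrite !ffunE -mulrA.
have S_sub : is_submodule S.
  split=> [|_ _ [t ->] [t' ->]|r _ [t ->]].
  - by exists 0; apply/ffunP => i; rewrite !ffunE mul0r.
  - by exists (t + t').
  by exists (r * t).
(* The hypothesis makes [v t |-> t * y] well defined; the coefficients [w] are the values of an
   extension on the unit vectors. *)
have [f fE] : exists f : V -> R^o, forall t, f (v t) = t * y.
  have tot z : exists b : R^o, forall t, z = v t -> b = t * y.
    have [[t ->]|nS] := pselect (S z); last by exists 0 => t zt; case: nS; exists t.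
    exists (t * y) => t' tt'; apply/eqP; rewrite -subr_eq0 -mulrBl; apply/eqP/xy => i.
    by have /ffunP/(_ i) := tt'; rewrite !ffunE mulrBl => ->; rewrite subrr.
  by have [f fP] := choice tot; exists f => t; apply: fP.
have f_lin : linear_on S f.
  split=> [_ _ [t ->] [t' ->]|r _ [t ->]]; first by rewrite -vD !fE mulrDl.
  by rewrite -vZ !fE -mulrA.
have [g gE] := injective_extend R_inj S_sub f_lin.
pose e i : V := [ffun i' => (i' == i)%:R : R].
exists (fun i => g (e i)); rewrite -[LHS]mul1r -fE -gE; last by exists 1.
have -> : v 1 = \sum_i x i *: e i.
  apply/ffunP => i; rewrite sum_ffunE (bigD1 i) //= !ffunE eqxx mul1r.
  rewrite [X in _ + X]big1 => [|i' /negPf i'i]; last first.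
    by rewrite !ffunE eq_sym i'i scaler0.
  by rewrite addr0 [RHS]mulr1.
by rewrite linear_sum; apply: eq_bigr => i _; apply: linearZ_LR.
Qed.

Lemma right_double_annihilator1 (x y : R) :
  (forall t, t * x = 0 -> t * y = 0) -> exists w, y = x * w.
Proof.
move=> xy; have [|w ->] := @right_double_annihilator 1 (fun=> x) y.
  by move=> t /(_ ord0); apply: xy.
by exists (w ord0); rewrite big_ord1.
Qed.

(** The left annihilators ascend, hence stop, and equal left annihilators give equal principal right
    ideals. *)
Lemma principal_right_dcc (a t : nat -> R) : (forall n, a n.+1 = a n * t n) ->
  exists n s, a n = a n.+1 * s.
Proof.
move=> aE; pose I n (r : R) := r * a n = 0.
have [||n nP] := R_noeth (I := I).
- move=> n; split=> [|x y Ix Iy|r x Ix]; rewrite /I ?mul0r //.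
    by rewrite mulrDl Ix Iy addr0.
  by rewrite -mulrA Ix mulr0.
- by move=> n x; rewrite /I aE mulrA => ->; rewrite mul0r.
by exists n; apply: right_double_annihilator1 => r; apply: (nP n.+1).
Qed.

(** A maximal annihilator [p] among nonzero submodules [R t m0] is prime. Descending principal right
    ideals stop, which gives a minimal right ideal modulo [p], hence a minimal left one [R e]; then
    [e] moves some multiple of [m0] to a simple element. *)
Lemma exists_simple (M : lmodType R) (m0 : M) : m0 <> 0 ->
  exists t : R, simple_elt (t *: m0).
Proof.
move=> m0_neq0.
pose Q (A : R^o -> Prop) := exists2 t : R, t *: m0 <> 0 & A = annihilator (t *: m0).
have [||p [t0 x_neq0 pE] p_max] := @noetherian_max R Q R_noeth.
- by move=> _ [t _ ->]; apply/two_sided_submodule/annihilator_two_sided.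
- by exists (annihilator (1 *: m0)), 1; rewrite ?scale1r.
set x := t0 *: m0 in x_neq0 pE.
have p_ideal : @two_sided R p by rewrite pE; apply: annihilator_two_sided.
have ann_sub s r : s *: x <> 0 -> annihilator (s *: x) r -> p r.
  move=> sx; apply: p_max; first by exists (s * t0); rewrite -scalerA.
  by move=> {}r; rewrite pE => pr s'; rewrite (scalerA s'); apply: pr.
have notin_p (r : R) : ~ p r -> exists s : R, r *: (s *: x) <> 0.
  move=> npr; apply: contrapT => nos; apply: npr; rewrite pE => s.
  by apply: contrapT => rsx; apply: nos; exists s.
have [||e npe e_min] := @prime_minimal_left R p p_ideal.
- move=> a b npa /notin_p[s bsx]; apply: contrapT => nor; apply: npa.
  rewrite scalerA in bsx; apply: (ann_sub (b * s)) => // r.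
  have : p (a * r * b) by apply: contrapT => npr; apply: nor; exists r.
  by rewrite pE => /(_ s); rewrite !scalerA !mulrA.
- apply: contrapT => nomin.
  have step (a : {a : R | ~ p a}) : exists b : {a : R | ~ p a},
      exists t, sval b = sval a * t /\ forall s, ~ @cong R p (sval a * t * s) (sval a).
    case: a => a npa; apply: contrapT => nob; apply: nomin; exists a => // t npat.
    apply: contrapT => nos; apply: nob; exists (exist _ (a * t) npat), t.
    by split=> // s ats; apply: nos; exists s.
  have [next nextP] := choice step.
  have [t tP] := choice nextP.
  have np1 : ~ p 1 by rewrite pE => /(_ 1); rewrite !scale1r.
  pose a n := iter n next (exist _ 1 np1).
  have [|n [s an]] := @principal_right_dcc (fun n => sval (a n)) (fun n => t (a n)).
    by move=> n; apply: (tP (a n)).1.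
  apply: ((tP (a n)).2 s); rewrite -(tP (a n)).1.
  by have -> : sval (next (a n)) * s = sval (a n) by []; apply: cong_refl.
have [s esx] := notin_p e npe; exists (e * s * t0).
have -> : e * s * t0 *: m0 = e *: (s *: x) by rewrite /x !scalerA.
split=> // t tesx.
have [|v ve] := e_min t.
  by rewrite pE => /(_ s); rewrite -scalerA => /tesx.
exists v; move: ve; rewrite /cong pE => /(_ s); rewrite scalerBl => /eqP.
by rewrite subr_eq0 => /eqP vE; rewrite -[RHS]vE !scalerA.
Qed.

(** The quotient [R / I] is realised as the image of a map with kernel [I]. *)
Lemma exists_simple_quotient (I : R^o -> Prop) : is_submodule I -> ~ I 1 ->
  exists (E : lmodType R) (phi : {linear R^o -> E}) (t : R),
    (forall r, phi r = 0 <-> I r) /\ simple_elt (phi t).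
Proof.
move=> I_sub nI1.
have [E _ [phi phiP]] := injective_cogenerators (fun _ : unit => I_sub).
have [|t t_simple] := @exists_simple E (phi tt 1); first by move=> /phiP.
exists E, (phi tt), t; split; first exact: phiP.
by rewrite -linearZ_LR [X in phi tt X]mulr1 in t_simple.
Qed.

(* Noetherian induction on the left ideals [C] below which descending chains stop. *)
Lemma left_dcc (L : nat -> R^o -> Prop) :
    (forall n, is_submodule (L n)) -> (forall n x, L n.+1 x -> L n x) ->
  exists n, forall m x, (n <= m)%N -> L n x -> L m x.
Proof.
move=> L_sub L_chain.
have L_mono m n x : (m <= n)%N -> L n x -> L m x.
  by move=> /subnK <-; elim: (n - m)%N => [//|k IHk] /L_chain/IHk.
pose Q (C : R^o -> Prop) := is_submodule C /\
  exists n, forall m x, (n <= m)%N -> C x -> L n x -> L m x.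
have [||C [C_sub [n nP]] C_max] := @noetherian_max R Q R_noeth.
- by move=> C [].
- exists (fun x => x = 0); split; first exact: zero_submodule.
  by exists 0%N => m x _ -> _; apply: submodule0.
have [C1|nC1] := pselect (C 1).
  exists n => m x nm; apply: nP => //; rewrite -[x]mulr1; exact: (submoduleZ C_sub).
have [E [phi [t [phiP [t_neq0 t_simple]]]]] := exists_simple_quotient C_sub nC1.
have nCt : ~ C t by move/phiP.
have t_min s : ~ C (s * t) -> exists v, C (v * s * t - t).
  move=> nCst; have [|v vE] := t_simple s.
    by rewrite -linearZ_LR; move/phiP.
  exists v; apply/phiP; rewrite linearB -[X in phi X - _]mulrA.
  rewrite -[X in phi X - _]/(v *: (s *: (t : R^o))).
  by rewrite !linearZ_LR [X in X - _]vE subrr.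
case: nCt; apply: (C_max (adjoin C t)); last exact: mem_adjoin; last exact: sub_adjoin.
split; first exact: adjoin_submodule.
(* Either some [L k] meets [C + R t] only inside [C], and the chain on [C] decides; or every [L m]
   contains some [y] of [C + R t] outside [C], and a multiple of [y] moves any element of [C + R t]
   into [C]. *)
have [out|stay] := pselect
    (exists k, forall x, adjoin C t x -> L k x -> C x).
  have [k kP] := out; exists (maxn k n) => m x; rewrite geq_max => /andP[km nm] C'x Lx.
  apply: nP => //; last by apply: L_mono Lx; apply: leq_maxr.
  by apply: kP => //; apply: L_mono Lx; apply: leq_maxl.
exists n => m x nm [c [r [Cc ->]]] Lx.
have [y [C'y Ly nCy]] : exists y, [/\ adjoin C t y, L m y & ~ C y].
  apply: contrapT => noy; apply: stay; exists m => y C'y Ly.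
  by apply: contrapT => nCy; apply: noy; exists y.
have [d [s [Cd yE]]] := C'y.
have [|v Cv] := t_min s.
  by move=> Cst; apply: nCy; rewrite yE; apply: (submoduleD C_sub Cd Cst).
have Cdiff : C (c + r *: (t : R^o) - (r * v) *: (y : R^o)).
  have -> : c + r *: (t : R^o) - (r * v) *: (y : R^o) =
      c - (r * v) *: (d : R^o) - r *: (v * s * t - t : R^o).
    rewrite yE -![_ *: _]/(_ * _) !mulrDr mulrN !mulrA opprB opprD -!addrA.
    by congr (_ + _); rewrite addrCA; congr (_ + _); rewrite addrC.
  apply: (submoduleB C_sub); last exact: (submoduleZ C_sub).
  by apply: (submoduleB C_sub) => //; apply: (submoduleZ C_sub).
rewrite -(subrK ((r * v) *: (y : R^o)) (c + _)).
apply: (submoduleD (L_sub m)); last exact: (submoduleZ (L_sub m)).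
apply: nP => //; apply: (submoduleB (L_sub n)) => //.
by apply: (submoduleZ (L_sub n)); apply: L_mono Ly.
Qed.

Lemma left_ideal_min (Q : (R^o -> Prop) -> Prop) :
    (forall I, Q I -> is_submodule I) -> (exists I, Q I) ->
  exists2 I, Q I & forall J, Q J -> (forall x, J x -> I x) -> forall x, I x -> J x.
Proof.
move=> Qsub [I0 QI0]; apply: contrapT => nomin.
have step (I : {I : R^o -> Prop | Q I}) : exists J : {I : R^o -> Prop | Q I},
    (forall x, sval J x -> sval I x) /\ ~ (forall x, sval I x -> sval J x).
  case: I => I QI /=; apply: contrapT => noJ; apply: nomin; exists I => // J QJ IJ.
  by apply: contrapT => nJI; apply: noJ; exists (exist _ J QJ).
have [next nextP] := choice step.
pose I n := sval (iter n next (exist _ I0 QI0)).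
have [||n nP] := @left_dcc I.
- by move=> n; apply: (Qsub (I n)); rewrite /I; case: (iter _ _ _).
- by move=> n x; apply: (nextP (iter n next _)).1.
by apply: (nextP (iter n next (exist _ I0 QI0))).2 => x; apply: (nP n.+1).
Qed.

Definition ann_seq (M : lmodType R) (s : seq M) : R^o -> Prop :=
  fun r => forall m, m \in s -> (r : R) *: m = 0.

Lemma ann_seq_submodule (M : lmodType R) (s : seq M) : is_submodule (ann_seq s).
Proof.
split=> [m _|x y Ax Ay m ms|r x Ax m ms]; first by rewrite scale0r.
  by rewrite scalerDl Ax // Ay // addr0.
by rewrite -scalerA Ax // scaler0.
Qed.

(** For a list in [S] with minimal annihilator, appending an element of [S] cannot shrink the
    annihilator. *)
Lemma ann_seq_stable (M : lmodType R) (S : M -> Prop) :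
  exists2 s : seq M, (forall m, m \in s -> S m) &
    forall (r : R) m, ann_seq s r -> S m -> r *: m = 0.
Proof.
pose Q (I : R^o -> Prop) :=
  exists2 s : seq M, (forall m, m \in s -> S m) & I = ann_seq s.
have [||_ [s sS ->] smin] := @left_ideal_min Q.
- by move=> _ [s _ ->]; apply: ann_seq_submodule.
- by exists (ann_seq ([::] : seq M)), [::].
exists s => // r m sr Sm; apply: (smin (ann_seq (m :: s))) sr _ _.
- by exists (m :: s) => // m'; rewrite inE => /predU1P[->|/sS].
- by move=> r' r'ms m' m's; apply: r'ms; rewrite inE m's orbT.
exact: mem_head.
Qed.

(** If [p] had zero left annihilator, so would a finite list from [p], and the double annihilator
    property would put 1 in [p]. A simple left ideal is then found inside the left annihilator. *)
Lemma two_sided_left_annihilator (p : R -> Prop) : two_sided p -> ~ p 1 ->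
  exists2 a : R, simple_elt (a : R^o) & forall x, p x -> a * x = 0.
Proof.
move=> p_ideal np1.
have [s sp sP] := @ann_seq_stable R^o p.
have [b b_neq0 bs] : exists2 b : R, b <> 0 & ann_seq s b.
  apply: contrapT => nob; apply: np1.
  have [|w ->] := @right_double_annihilator _ (tnth (in_tuple s)) 1.
    move=> t ts; rewrite mulr1; apply: contrapT => t_neq0; apply: nob; exists t => //.
    move=> m ms; have /tnthP[i ->] : m \in in_tuple s by [].
    exact: ts.
  apply: (big_ind p); [by case: p_ideal | exact: two_sidedD |] => i _.
  by apply: two_sidedMr => //; apply/sp/mem_tnth.
have [t t_simple] := @exists_simple R^o b b_neq0.
exists (t * b) => // x px; rewrite -mulrA.
by have -> : b * x = 0 by [apply: sP]; rewrite mulr0.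
Qed.

Lemma simple_scale (M : lmodType R) (m : M) (c : R) :
  simple_elt m -> c *: m <> 0 -> simple_elt (c *: m).
Proof.
move=> [m_neq0 m_simple] cm; split=> // t tcm.
have [|s sE] := m_simple (t * c); first by rewrite -scalerA.
by exists (c * s); rewrite -scalerA (scalerA t) sE.
Qed.

Lemma simple_ann_max (M N : lmodType R) (m : M) (n : N) :
    simple_elt m -> n <> 0 -> (forall r : R, r *: m = 0 -> r *: n = 0) ->
  forall r : R, r *: n = 0 -> r *: m = 0.
Proof.
move=> [_ m_simple] n_neq0 mn r rn; apply: contrapT => /m_simple[s sE].
apply: n_neq0; have /mn : (s * r - 1) *: m = 0.
  by rewrite scalerBl -scalerA sE scale1r subrr.
by rewrite scalerBl -scalerA rn scaler0 scale1r sub0r => /eqP; rewrite oppr_eq0 => /eqP.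
Qed.

(* [R / annihilator m] embeds in a finite power of the simple module [R m]. *)
Lemma simple_iso (M N : lmodType R) (m : M) (y : N) :
    simple_elt m -> simple_elt y -> (forall r, annihilator m r -> r *: y = 0) ->
  exists2 c : R, c *: m <> 0 & forall r : R, r *: (c *: m) = 0 <-> r *: y = 0.
Proof.
move=> m_simple y_simple my.
have [s sm sP] := @ann_seq_stable M (fun x => exists s : R, x = s *: m).
have {sP my} : forall r : R, ann_seq s r -> r *: y = 0.
  by move=> r sr; apply: my => t; apply: sP sr _; exists t.
elim: s sm => [|x s IHs] sm sy.
  by case: y_simple => + _; case; rewrite -[y]scale1r; apply: sy.
have [sy'|nsy] := pselect (forall r : R, ann_seq s r -> r *: y = 0).
  by apply: IHs => // x' x's; apply: sm; rewrite inE x's orbT.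
(* When [x] cannot be dropped from the list, some [t] kills the remaining elements but not [y];
   after normalising to [v t y = y], the element [v t x] has the annihilator of [y]. *)
have [t [st ty]] : exists t : R, ann_seq s t /\ t *: y <> 0.
  apply: contrapT => not; apply: nsy => r sr.
  by apply: contrapT => ry; apply: not; exists r.
have [v vty] := y_simple.2 t ty; rewrite scalerA in vty.
have [x0 xE] := sm x (mem_head _ _).
have svt r : r *: ((v * t) *: x) = 0 -> r *: y = 0.
  move=> rx; rewrite -vty scalerA; apply: sy => x'; rewrite inE => /predU1P[->|x's].
    by rewrite -scalerA.
  by rewrite -!scalerA st // !scaler0.
have vtx : (v * t * x0) *: m = (v * t) *: x by rewrite xE scalerA.
have c_neq0 : (v * t * x0) *: m <> 0.
  rewrite vtx => vtx0; case: y_simple => + _; apply.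
  by rewrite -[y]scale1r svt // vtx0 scaler0.
exists (v * t * x0) => // r; split; first by rewrite vtx; apply: svt.
apply: simple_ann_max (simple_scale m_simple c_neq0) (y_simple.1) _ _ => {}r.
by rewrite vtx; apply: svt.
Qed.

Lemma simple_annihilator (M N : lmodType R) (m : M) (y : N) :
    simple_elt m -> simple_elt y -> (forall r, annihilator m r -> r *: y = 0) ->
  forall r, annihilator y r -> annihilator m r.
Proof.
move=> m_simple y_simple my r ry s.
have [c c_neq0 cP] := simple_iso m_simple y_simple my.
have [v vE] := m_simple.2 c c_neq0.
have : (r * s * v) *: y = 0 by rewrite -mulrA -scalerA ry.
by move=> /cP; rewrite -scalerA vE -scalerA.
Qed.

(** * Maximal two-sided ideals and embeddings into free modules *)

Definition maximal_ideal (p : R -> Prop) :=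
  [/\ two_sided p, ~ p 1 & forall q, two_sided q -> ~ q 1 ->
    (forall r, p r -> q r) -> forall r, q r -> p r].

(** For a proper [q] above the annihilator of [m], a simple submodule of [R / q] is killed by [q]
    and isomorphic to [R m], so [q] kills [R m]. *)
Lemma simple_maximal_ideal (M : lmodType R) (m : M) :
  simple_elt m -> maximal_ideal (annihilator m).
Proof.
move=> m_simple; split; first exact: annihilator_two_sided.
  by move=> /(_ 1); rewrite !scale1r; apply: m_simple.1.
move=> q q_ideal nq1 pq r qr.
have [E [phi [t [phiP t_simple]]]] :=
  exists_simple_quotient (two_sided_submodule q_ideal) nq1.
have q_ann r' : q r' -> annihilator (phi t) r'.
  move=> qr' s; rewrite -!linearZ_LR; apply/phiP.
  exact: (two_sidedMr q_ideal (s * t) qr').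
apply: (simple_annihilator m_simple t_simple) (q_ann r qr) => r' /pq/q_ann.
by move=> /(_ 1); rewrite scale1r.
Qed.

Lemma maximal_ideal_comax (p q : R -> Prop) :
    maximal_ideal p -> maximal_ideal q -> ~ (forall r, p r -> q r) ->
  exists c d, [/\ p c, q d & c + d = 1].
Proof.
move=> [p_ideal _ _] [q_ideal nq1 q_max] npq.
pose pq r := exists c d, [/\ p c, q d & r = c + d].
have [p0 _ _ _] := p_ideal; have [q0 _ _ _] := q_ideal.
have pq_ideal : two_sided pq.
  split.
  - by exists 0, 0; rewrite addr0.
  - move=> _ _ [c [d [pc qd ->]]] [c' [d' [pc' qd' ->]]].
    exists (c + c'), (d + d'); rewrite addrACA.
    by split=> //; [exact: (two_sidedD p_ideal) | exact: (two_sidedD q_ideal)].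
  - move=> r _ [c [d [pc qd ->]]]; exists (r * c), (r * d); rewrite mulrDr.
    by split=> //; [exact: (two_sidedMl p_ideal) | exact: (two_sidedMl q_ideal)].
  move=> r _ [c [d [pc qd ->]]]; exists (c * r), (d * r); rewrite mulrDl.
  by split=> //; [exact: (two_sidedMr p_ideal) | exact: (two_sidedMr q_ideal)].
have [[c [d [pc qd cd]]]|npq1] := pselect (pq 1); first by exists c, d.
case: npq => r pr; apply: (q_max pq pq_ideal npq1).
  by move=> r' qr'; exists 0, r'; rewrite add0r.
by exists r, 0; rewrite addr0.
Qed.

(* If [R m] does not embed in [R], walk back along the Nakayama permutation:
   [R (a k)] is a simple left ideal killed on the right by [p k], and [p k.+1] is
   its left annihilator. The [p k] are pairwise distinct, so the sums of the
   [R (a k)] form a strictly ascending chain. *)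
Lemma left_kasch (M : lmodType R) (m : M) : simple_elt m ->
  exists2 a : R, a <> 0 & forall r : R, r *: m = 0 -> r * a = 0.
Proof.
move=> m_simple; apply: contrapT => no_embed.
have tot (p : R -> Prop) : exists a : R, maximal_ideal p ->
    simple_elt (a : R^o) /\ forall x, p x -> a * x = 0.
  have [[p_ideal np1 p_max]|np] := pselect (maximal_ideal p); last by exists 0.
  by have [a a_simple ap] := two_sided_left_annihilator p_ideal np1; exists a.
have [A AP] := choice tot.
pose p := fix p k := if k is k'.+1 then annihilator (A (p k') : R^o) else annihilator m.
have p_max k : maximal_ideal (p k).
  elim: k => [|k IHk]; first exact: simple_maximal_ideal.
  by apply: simple_maximal_ideal; case: (AP (p k) IHk).
pose a k : R^o := A (p k).
have a_simple k : simple_elt (a k) by case: (AP (p k) (p_max k)).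
have ap k x : p k x -> a k * x = 0 by case: (AP (p k) (p_max k)) => _; apply.
have pS k : p k.+1 = annihilator (a k) by [].
have p_sub i j : (forall r, p i r -> p j r) -> forall r, p j r -> p i r.
  have [_ _ pi_max] := p_max i; have [pj_ideal npj1 _] := p_max j.
  exact: pi_max.
(* The Nakayama permutation is injective: if [R (a i)] and [R (a j)] are isomorphic, a nonzero
   multiple of [a i] lies in [a j * R], so [p j] kills [R (a i)] on the right and is contained in
   [p i]. *)
have p_pred i j : (forall r, p i.+1 r -> p j.+1 r) -> forall r, p j r -> p i r.
  move=> pij.
  have [|c c_neq0 cP] := simple_iso (a_simple i) (a_simple j).
    by move=> r /pij/(_ 1); rewrite scale1r.
  have [|w wE] := @right_double_annihilator1 (a j) (c *: a i).
    by move=> t /cP.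
  have [v vE] := (a_simple i).2 c c_neq0.
  pose q t := forall s, a i * (s * t) = 0.
  have q_ideal : two_sided q.
    split=> [s|x y qx qy s|r x qx s|r x qx s].
    - by rewrite !mulr0.
    - by rewrite !mulrDr qx qy addr0.
    - by rewrite [s * _]mulrA qx.
    by rewrite !mulrA -[_ * s * x]mulrA qx mul0r.
  have [_ _ pi_max] := p_max i; have [pi_ideal _ _] := p_max i.
  have [pj_ideal _ _] := p_max j.
  move=> r pjr; apply: (pi_max q q_ideal).
  - by move=> /(_ 1); rewrite !mulr1; apply: (a_simple i).1.
  - by move=> x pix s; apply: ap; apply: (two_sidedMl pi_ideal).
  move=> s; rewrite -vE wE -[_ *: _]/(v * (a j * w)) -!mulrA ap ?mulr0 //.
  by rewrite mulrA; apply: (two_sidedMl pj_ideal).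
(* Walking back [i] steps reduces a repetition to one of [p 0]; then [R m] is isomorphic to
   [R (a d)] and embeds in [R]. *)
have p_neq i d : ~ (forall r, p i r -> p (i + d.+1)%N r).
  move=> pid; have : forall r, p d.+1 r -> p 0%N r.
    elim: i pid => [|i IHi] pid; first exact: p_sub.
    by apply: IHi; apply: p_sub; apply: p_pred.
  move=> p0; apply: no_embed.
  have [|c c_neq0 cP] := simple_iso (a_simple d) m_simple.
    by move=> r /p0/(_ 1); rewrite scale1r.
  by exists (c * a d) => // r /cP.
pose W := fix W k : R^o -> Prop :=
  if k is k'.+1 then adjoin (W k') (a k') else fun x => x = 0.
have W_sub k : is_submodule (W k).
  by elim: k => [|k IHk]; [exact: zero_submodule | exact: adjoin_submodule].
have [||n nP] := @R_noeth W.
- exact: W_sub.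
- by move=> k x; apply: sub_adjoin.
have Wan : W n (a n) by apply: (nP n.+1) => //; apply: mem_adjoin.
apply: (a_simple n).1.
(* Comaximality of [p k.+1] and [p n.+1] strips the last summand [R (a k)] from an element killed by
   [p n.+1]. *)
suff W0 k x : (k <= n)%N -> W k x -> (forall r, p n.+1 r -> r * x = 0) -> x = 0.
  apply: (W0 n) => // r; rewrite pS => /(_ 1); by rewrite scale1r.
elim: k x => [//|k IHk] x ltkn [y [r [Wy xE]]] px.
have [c [d [pc pd cd1]]] : exists c d, [/\ p k.+1 c, p n.+1 d & c + d = 1].
  apply: maximal_ideal_comax => //.
  by have := @p_neq k.+1 (n - k.+1)%N; rewrite addnS subnKC.
have xcy : x = c * y.
  rewrite -[LHS]mul1r -cd1 mulrDl (px d) // addr0 xE mulrDr.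
  have -> : c * (r *: a k) = 0 by move: pc; rewrite pS; apply.
  by rewrite addr0.
apply: IHk px; first exact: ltnW.
by rewrite xcy; apply: (submoduleZ (W_sub k)).
Qed.

(** Take a maximal injective partial map whose values are supported in its own domain. A simple
    element [y] outside the domain could be sent to the coordinate [y], still free, by [left_kasch];
    so the domain contains all simple elements. An extension to [M] by injectivity then has a kernel
    without simple submodules, which is zero. *)
Lemma embed_free (M : lmodType R) :
  exists h : {linear M -> free_module R M}, injective h.
Proof.
pose F := free_module R M.
pose dom (G : set (M * F)) x := exists f, G (x, f).
pose P (G : set (M * F)) := [/\ is_submodule G,
  forall f, G (0, f) -> f = 0, forall x, G (x, 0) -> x = 0 &
  forall x f y, G (x, f) -> fseval f y <> 0 -> dom G y].
have P0 : P (fun z => z = 0).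
  split; first exact: zero_submodule.
  - by move=> f [].
  - by move=> x [].
  by move=> x f y [_ ->].
have [|G [[G_sub G_fun G_inj G_supp] _ G_max]] := Zorn_above P0.
  move=> C C0 CP C_tot; split.
  - by apply: chain_submodule => // X /CP[].
  - by move=> f [X /CP[_ + _ _] Xf]; apply.
  - by move=> x [X /CP[_ _ + _] Xx]; apply.
  move=> x f y [X CX Xf] fy; have [_ _ _ /(_ x f y Xf fy)[g Xg]] := CP X CX.
  by exists g, X.
have G_uniq x f f' : G (x, f) -> G (x, f') -> f = f'.
  move=> Gf Gf'; apply/eqP; rewrite -subr_eq0; apply/eqP/G_fun.
  by have : G (x - x, f - f') := submoduleB G_sub Gf Gf'; rewrite subrr.
have dom_sub : is_submodule (dom G).
  split=> [|x y [f Gf] [g Gg]|r x [f Gf]].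
  - by exists 0; apply: (submodule0 G_sub).
  - by exists (f + g); apply: (submoduleD G_sub Gf Gg).
  by exists (r *: f); apply: (submoduleZ G_sub r Gf).
have dom_simple y : simple_elt y -> dom G y.
  move=> y_simple; apply: contrapT => ndy; have [a a_neq0 ya] := left_kasch y_simple.
  have ay := simple_ann_max (N := R^o) y_simple a_neq0 ya.
  have y_indep r : dom G (r *: y) -> r *: y = 0.
    move=> dry; apply: contrapT => /y_simple.2[s sE]; apply: ndy; rewrite -sE.
    exact: submoduleZ.
  pose fy : F := fsingle y (a : R^o).
  apply: (ndy); exists fy; apply: (G_max (adjoin G (y, fy))); last exact: mem_adjoin;
    last by move=> z; apply: sub_adjoin.
  have fy_scale r : r *: y = 0 -> r *: fy = 0.
    move=> /ya ra; apply: fsext => z; rewrite fsevalZ fsingleE.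
    by case: eqP => _; rewrite ?scaler0.
  split; first exact: adjoin_submodule.
  - move=> f [[d g] [r [Gdg [/= dE ->]]]].
    have ry0 : r *: y = 0.
      apply: y_indep; exists (- g).
      have -> : r *: y = - d by apply/eqP; rewrite -addr_eq0 addrC -dE.
      exact: (submoduleN G_sub Gdg).
    rewrite fy_scale // addr0; apply: G_fun.
    by have -> : 0 = d by rewrite dE ry0 addr0.
  - move=> x [[d g] [r [Gdg zE]]].
    have xE : x = d + r *: y := congr1 fst zE.
    have gE : 0 = g + r *: fy := congr1 snd zE.
    have gy : fseval g y = 0.
      by apply: contrapT => gy; apply: (ndy); apply: (G_supp d g).
    have ry0 : r *: y = 0.
      apply: ay; have := congr1 (@fseval _ _ _ ^~ y) gE.
      by rewrite fsevalD fsevalZ gy add0r fsingleE eqxx => <-.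
    rewrite xE ry0 addr0; apply: G_inj.
    by have -> : 0 = g by rewrite gE fy_scale // addr0.
  move=> x f z [[d g] [r [Gdg [_ ->]]]]; rewrite fsevalD fsevalZ fsingleE.
  have [->|_] := altP (z =P y); first by exists fy; apply: mem_adjoin.
  rewrite scaler0 addr0 => gz; have [h Gh] := G_supp _ _ _ Gdg gz.
  by exists h; apply: sub_adjoin.
have tot x : exists f, dom G x -> G (x, f).
  by have [[f Gf]|nx] := pselect (dom G x); [exists f | exists 0].
have [f fP] := choice tot.
have f_lin : linear_on (dom G) f.
  split=> [x y dx dy|r x dx].
    apply: (@G_uniq (x + y)); first by apply: fP; apply: submoduleD.
    exact: (submoduleD G_sub (fP x dx) (fP y dy)).
  apply: (@G_uniq (r *: x)); first by apply: fP; apply: submoduleZ.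
  exact: (submoduleZ G_sub r (fP x dx)).
have F_inj : injective_module F.
  by apply: qF_eq_flat_injective; [split | exact: eq_flat_free].
have [h hE] := injective_extend F_inj dom_sub f_lin.
exists h => x y eq_xy; apply/eqP; rewrite -subr_eq0; apply/eqP.
apply: contrapT => /exists_simple[t t_simple]; have dt := dom_simple _ t_simple.
apply: t_simple.1; apply: G_inj; have := fP _ dt.
by rewrite -hE // linearZ_LR linearB eq_xy subrr scaler0.
Qed.

End QuasiFrobenius.

Theorem proposition4p2 (R : pzRingType) :
  quasi_Frobenius R <->
  (forall M N : lmodType R,
     flat_precover_completing_domain M N <-> subinjectivity_domain N M).
Proof.
split=> [R_qF M N|]; last exact: domains_quasi_Frobenius.
have flat_inj (V : lmodType R) : eq_flat V -> injective_module V.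
  exact: qF_eq_flat_injective.
split=> [dom K i i_inj f|sub f F g g_cover].
  have [h hE] := dom f _ _ (free_flat_precover N flat_inj).
  have [k kE] := flat_inj _ (@eq_flat_free R N) _ _ _ i_inj h.
  exists (free_lift id \o k) => x; rewrite -[RHS]hE.
  by congr (free_lift id _ : N); apply: kE.
have [R_noeth R_inj] := R_qF.
have [h h_inj] := embed_free R_noeth R_inj M.
have [f' f'E] := sub _ _ h_inj f.
have [v vE] := g_cover.2 _ (eq_flat_flat (@eq_flat_free R M)) f'.
by exists (v \o h) => x; rewrite -[RHS]f'E; apply: vE.
Qed.
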